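(* For any real $p>1$ and any integer $m\ge 2$ there exists a constant $C_{p,m}$, depending only on $p$ and $m$, such that for every integer $N\ge 1$ and every function $f:\mathbb Z_{m+1}^N\to\mathbb C$, $$\|M^N f\|_{L^p(\mathbb Z_{m+1}^N)}\le C_{p,m}\,\|f\|_{L^p(\mathbb Z_{m+1}^N)},$$ where $M^N f(x)=\sup_{0\le r\le N}|\sigma_r*f(x)|$ is the spherical maximal operator. In particular the bound is independent of the dimension $N$.
   Context: For $y=(y(1),\dots,y(N))\in\mathbb Z_{m+1}^N$ let $|y|:=|\{1\le i\le N: y(i)\ne 0\}|$ (the $l^0$ or Hamming metric). For an integer $0\le r\le N$ let $\mathbb S_r:=\{x\in\mathbb Z_{m+1}^N:|x|=r\}$ and $\sigma_r:=\frac{1}{|\mathbb S_r|}1_{\mathbb S_r}$. Convolution is $g*f(x)=\sum_{y\in\mathbb Z_{m+1}^N} g(y)f(x-y)$, and $L^p$ norms are taken with respect to counting measure. The supremum is over integers $r$. *)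

(* Defs.v *)
From HB Require Import structures.
From mathcomp Require Import all_boot all_order all_algebra.
From mathcomp Require Import reals exp complex.
Set Implicit Arguments. Unset Strict Implicit. Unset Printing Implicit Defensive.
Import Order.TTheory GRing.Theory Num.Theory.
Local Open Scope ring_scope.
Local Open Scope complex_scope.

(* 'Z_m.+1 is the ring of integers modulo m+1 only for m >= 1. *)
Definition hamming_norm (m N : nat) (y : 'rV['Z_m.+1]_N) : nat :=
  #|[set i : 'I_N | y 0 i != 0]|.

Definition sphere (m N r : nat) : {set 'rV['Z_m.+1]_N} :=
  [set x | hamming_norm x == r].

Definition sigma (R : realType) (m N r : nat) (x : 'rV['Z_m.+1]_N) : R[i] :=
  (#|sphere m N r|%:R)^-1 * (x \in sphere m N r)%:R.

Definition convolution (R : realType) (G : finZmodType) (g f : G -> R[i])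
    (x : G) : R[i] :=
  \sum_(y : G) g y * f (x - y).

(* [normc] is the modulus as an element of R. The supremum is over the finite
   nonempty set 0 <= r <= N and its terms are nonnegative, so the default
   value 0 is harmless. *)
Definition spherical_maximal (R : realType) (m N : nat)
    (f : 'rV['Z_m.+1]_N -> R[i]) (x : 'rV['Z_m.+1]_N) : R :=
  \big[Num.max/0]_(r < N.+1) ComplexField.Normc.normc
    (convolution (@sigma R m N r) f x).

(* L^p norm for the counting measure on a finite type. The target V is R
   itself, or [Rcomplex R], i.e. R[i] with the R-valued modulus as norm. *)
Definition Lp_norm (R : realType) (V : normedZmodType R) (T : finType)
    (p : R) (f : T -> V) : R :=
  powR (\sum_(x : T) powR `|f x| p) p^-1.

(* Main.v *)
Require Import Defs.
From mathcomp Require Import all_boot all_order all_algebra.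
From mathcomp Require Import reals exp complex.
From mathcomp Require Import zify ring lra.
Set Implicit Arguments. Unset Strict Implicit. Unset Printing Implicit Defensive.
Import Order.TTheory GRing.Theory Num.Theory.
Local Open Scope ring_scope.
Local Open Scope complex_scope.

(* Write F r for the average of |f| over the sphere of radius r. As functions of
   r, the eigenvalues of these averages are normalized Krawtchouk polynomials
   kappa_k(r) = E [(-1/m)^H] with H hypergeometric. Since 1/m <= 1/2 < 1 they
   decay like exp(-c k r / N) on the whole range 0 <= r <= N (this fails for
   m = 1), and their K-th differences gain a factor (k/N)^K. By Parseval the
   square function (sum_r r^(2K-1) |Delta^K F(r)|^2)^(1/2) is bounded on L^2.
   Taking K-fold differences with a step of order 2^(-i) r gives, for every i,
     F r <= C 2^i (maximal Cesaro mean of F) + 2^(-i(K-1/2)) (square function).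
   The Cesaro means are dominated by ergodic averages of the nearest neighbour
   walk, hence of weak type (1,1) by Hopf's maximal inequality. Splitting f
   into level bands and choosing i according to the height of the band gives
   L^p bounds as soon as K is large in terms of 1/(p - 1). *)

(** * Hypergeometric generating function *)

(** The two basic estimates, weak type (1,1) for Cesaro means and L^2 for differences in r, do not
    by themselves reach p < 2 for spherical averages. The parameter i does by hand what Stein's
    complex interpolation would do: a loss of 2^i on the L^1 side buys 2^(-i(2K-1)) on the squared
    L^2 side. A band d levels of ratio b = 2^(2K-1) above a level t has squared L^2 norm at most t
    b^d times its L^1 norm, so the choice i = d cancels b^d. What remains, 4^d / t times the L^1
    norm, is summable against t^p once b^(p-1) >= 8, which fixes K. The part of f below t
    contributes at most t in sup norm, so large p needs no separate argument. The weight r^(2K-1) is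
    dictated by scaling: the sum over r of r^(2K-1) (k/N)^(2K) exp(-c k r / N) is bounded uniformly
    in k and N. No characters appear: Parseval is proved over the reals, one coordinate at a time,
    by splitting off the mean in that coordinate. *)

(* E [c^H], where H is the number of bad elements among x draws without
   replacement from a bad and b good ones, by conditioning on the first draw. *)
Fixpoint hyp (R : realFieldType) (c : R) (x a b : nat) : R :=
  if x is x'.+1 then
    (a%:R * c * hyp c x' a.-1 b + b%:R * hyp c x' a b.-1) / (a + b)%:R
  else 1.

Lemma hyp0 (R : realFieldType) (c : R) a b : hyp c 0 a b = 1.
Proof. by []. Qed.

Lemma hypSE (R : realFieldType) (c : R) x a b : hyp c x.+1 a b =
  (a%:R * c * hyp c x a.-1 b + b%:R * hyp c x a b.-1) / (a + b)%:R.
Proof. by []. Qed.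

Arguments hyp : simpl never.

Lemma hypS (R : realFieldType) (c : R) x a b : (0 < a + b)%N ->
  (a + b)%:R * hyp c x.+1 a b =
  a%:R * c * hyp c x a.-1 b + b%:R * hyp c x a b.-1.
Proof.
by move=> h; rewrite hypSE mulrC divfK // pnatr_eq0 -lt0n.
Qed.

(** By exchangeability the last of x + 1 draws is bad with probability a/(a + b), and then the other
    x come from a - 1 bad and b good elements. The induction obtains this from conditioning on the
    first draw alone. *)
Lemma hyp_diff (R : realFieldType) (c : R) x a b : (x < a + b)%N ->
  (a + b)%:R * (hyp c x.+1 a b - hyp c x a b) =
  - (1 - c) * a%:R * hyp c x a.-1 b.
Proof.
elim: x a b => [|x IH] a b h.
  rewrite mulrBr hypS // !hyp0 !natrD; ring.
have h0 : (0 < a + b)%N by lia.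
rewrite mulrBr !hypS //.
have nz : (a + b).-1%:R != 0 :> R by rewrite pnatr_eq0; lia.
apply: (mulfI nz).
case: a => [|a] in h h0 nz *; case: b => [|b] in h h0 nz *; rewrite ?mul0r ?add0r ?addr0.
- by [].
- have := IH 0%N b; rewrite !add0n in h nz * => /(_ h) E.
  rewrite -mulrBr mulrCA /=; rewrite -[X in _ * X]/(b%:R * (hyp c x.+1 0 b - hyp c x 0 b)) E; ring.
- have := IH a 0%N; rewrite !addn0 in h nz * => /(_ h) /= E.
  have := hypS c x (a:=a) (b:=0); rewrite !addn0 mul0r addr0 => /(_ ltac:(lia)) /= E2.
  transitivity (a.+1%:R * c * (a%:R * (hyp c x.+1 a 0 - hyp c x a 0))); first by rewrite /= ?addn0; ring.
  rewrite E; transitivity (- (1 - c) * a.+1%:R * (a%:R * hyp c x.+1 a 0)); last by rewrite /= ?addn0; ring.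
  rewrite E2; ring.
- have := IH a b.+1 ltac:(lia) => /= E1.
  have := IH a.+1 b ltac:(lia) => /= E2.
  have := hypS c x (a:=a) (b:=b.+1) ltac:(lia) => /= E3.
  have e : (a.+1 + b.+1).-1%:R = (a + b.+1)%:R :> R by congr (_%:R).
  have e' : (a.+1 + b.+1).-1%:R = (a.+1 + b)%:R :> R by congr (_%:R); lia.
  transitivity (a.+1%:R * c * ((a + b.+1)%:R * (hyp c x.+1 a b.+1 - hyp c x a b.+1)) +
    b.+1%:R * ((a.+1 + b)%:R * (hyp c x.+1 a.+1 b - hyp c x a.+1 b))).
    by rewrite -e' -e /=; ring.
  rewrite /= E1 E2.
  transitivity (- (1 - c) * a.+1%:R * ((a + b.+1)%:R * hyp c x.+1 a b.+1)).
    by rewrite /= E3; ring.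
  by rewrite -e /=; ring.
Qed.

Lemma hyp_ge0 (R : realFieldType) (c : R) x a b : 0 <= c -> 0 <= hyp c x a b.
Proof.
move=> c0; elim: x a b => [|x IH] a b; rewrite ?hyp0 // hypSE.
by rewrite divr_ge0 ?ler0n // addr_ge0 // ?mulr_ge0 ?ler0n ?IH.
Qed.

Lemma normr_hyp (R : realFieldType) (c : R) x a b :
  `|hyp c x a b| <= hyp `|c| x a b.
Proof.
elim: x a b => [|x IH] a b; first by rewrite !hyp0 normr1.
rewrite !hypSE.
rewrite normrM [X in _ * X]ger0_norm ?invr_ge0 ?ler0n //.
rewrite ler_wpM2r ?invr_ge0 ?ler0n //.
apply: le_trans (ler_normD _ _) _; rewrite !normrM !normr_nat.
by apply: lerD; apply: ler_wpM2l; rewrite ?IH ?mulr_ge0 ?ler0n.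
Qed.

Lemma hyp_succ_ge (R : realFieldType) (c : R) x a b : 0 <= c <= 1 ->
  (x < a + b)%N -> c * hyp c x a b <= hyp c x.+1 a b.
Proof.
move=> /andP[c0 c1]; elim: x a b => [|x IH] a b h.
  rewrite hypSE !hyp0 !mulr1 ler_pdivlMr ?ltr0n // natrD mulrDr [c * a%:R]mulrC lerD2l.
  by rewrite ler_piMl ?ler0n.
have h0 : 0 < (a + b)%:R :> R by rewrite ltr0n; lia.
rewrite -(ler_pM2l h0) mulrCA !hypS; [|lia|lia].
rewrite mulrDr; apply: lerD.
  case: a => [|a] in h h0 *; first by rewrite !mul0r mulr0.
  rewrite mulrCA; apply: ler_wpM2l; first by rewrite mulr_ge0 ?ler0n.
  by apply: IH; lia.
case: b => [|b] in h h0 *; first by rewrite !mul0r mulr0.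
by rewrite mulrCA; apply: ler_wpM2l; rewrite ?ler0n //; apply: IH; lia.
Qed.

Lemma hyp_remove_bad (R : realFieldType) (c : R) x a b : 0 <= c <= 1 ->
  (x <= a + b)%N -> hyp c x a.+1 b <= hyp c x a b.
Proof.
move=> c01; have /andP[c0 c1] := c01; elim: x a b => [|x IH] a b h //.
have h0 : 0 < (a.+1 + b)%:R :> R by rewrite ltr0n.
rewrite -(ler_pM2l h0).
have h1 : (0 < a + b)%N by lia.
(* Of the weight a + 1 + b one unit is set aside for the extra bad element, where [hyp_succ_ge]
   applies; the rest is compared term by term by induction. *)
have -> : (a.+1 + b)%:R * hyp c x.+1 a b = hyp c x.+1 a b + (a + b)%:R * hyp c x.+1 a b.
  by rewrite addSn -natr1; ring.
rewrite !hypS //=.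
have I0 := hyp_succ_ge c01 h.
have I1 : a%:R * c * hyp c x a b <= a%:R * c * hyp c x a.-1 b.
  case: a => [|a] in h h0 h1 I0 *; first by rewrite !mul0r.
  by apply: ler_wpM2l; [rewrite mulr_ge0 ?ler0n | apply: IH; lia].
have I2 : b%:R * hyp c x a.+1 b.-1 <= b%:R * hyp c x a b.-1.
  case: b => [|b] in h h0 h1 I0 I1 *; first by rewrite !mul0r.
  by apply: ler_wpM2l; [rewrite ler0n | apply: IH; lia].
by rewrite -natr1 !mulrDl mul1r; lra.
Qed.

(** Sampling with replacement dominates: by [hyp_diff] one more draw subtracts (1 - c) t times a
    value with one bad element less, which is at least the current value by [hyp_remove_bad]. *)
Lemma hyp_le_expn (R : realFieldType) (c : R) x a b : 0 <= c <= 1 ->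
  (x <= a + b)%N -> hyp c x a b <= (1 - (1 - c) * (a%:R / (a + b)%:R)) ^+ x.
Proof.
move=> c01; have /andP[c0 c1] := c01; elim: x => [|x IH] h //.
have n0 : 0 < (a + b)%:R :> R by rewrite ltr0n; lia.
set t := a%:R / (a + b)%:R.
have t1 : 0 <= t <= 1.
  by rewrite divr_ge0 ?ler0n //= ler_pdivrMr // mul1r ler_nat leq_addr.
have t2 : 0 <= 1 - (1 - c) * t by nra.
have D : hyp c x.+1 a b = hyp c x a b - (1 - c) * t * hyp c x a.-1 b.
  have E := hyp_diff c (h : (x < a + b)%N).
  apply: (mulfI (lt0r_neq0 n0)); rewrite mulrBr.
  have -> : (a + b)%:R * ((1 - c) * t * hyp c x a.-1 b) = (1 - c) * a%:R * hyp c x a.-1 b.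
    by rewrite -[in RHS](divfK (lt0r_neq0 n0) a%:R) -/t; ring.
  by move: E; rewrite mulrBr => E; lra.
apply: (@le_trans _ _ ((1 - (1 - c) * t) * hyp c x a b)); last first.
  by rewrite exprS; apply: ler_wpM2l => //; apply: IH; lia.
suff : (1 - c) * t * hyp c x a b <= (1 - c) * t * hyp c x a.-1 b by rewrite D; lra.
case: a => [|a] in h t n0 t1 t2 D IH *; first by rewrite /t !mul0r mulr0 !mul0r.
apply: ler_wpM2l; first by apply: mulr_ge0; lra.
by apply: hyp_remove_bad => //; lia.
Qed.

(** The added element is among the r + 1 draws with probability (r + 1)/(a + b + 1). For r = a + b
    the meaningless value at r + 1 draws from a + b elements is multiplied by 0. With [hyp_add_good]
    this yields the Krawtchouk recursions. *)
Lemma hyp_add_bad (R : realFieldType) (c : R) r a b : (r <= a + b)%N ->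
  (a + b).+1%:R * hyp c r.+1 a.+1 b =
  ((a + b)%:R - r%:R) * hyp c r.+1 a b + r.+1%:R * c * hyp c r a b.
Proof.
elim: r a b => [|r IH] a b h.
  rewrite -addSn hypS // subr0.
  case: (posnP (a + b)) => [/eqP|h0]; last by rewrite hypS // !hyp0 -natr1; ring.
  by rewrite addn_eq0 => /andP[/eqP-> /eqP->]; rewrite hypSE !hyp0 /=; ring.
rewrite -addSn hypS //=.
have h0 : (0 < a + b)%N by lia.
have nz : (a + b)%:R != 0 :> R by rewrite pnatr_eq0; lia.
have E0 := hypS c r.+1 h0.
have E1 := hypS c r h0.
have B : (a + b)%:R * (b%:R * hyp c r.+1 a.+1 b.-1) =
    b%:R * (((a + b)%:R - r.+1%:R) * hyp c r.+1 a b.-1 + r.+1%:R * c * hyp c r a b.-1).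
  case: b => [|b] in h h0 nz E0 E1 *; first by rewrite !mul0r mulr0.
  have := IH a b ltac:(lia) => /= E; rewrite mulrCA addnS /= E.
  by rewrite -!natr1; ring.
have A : (a + b)%:R * (a%:R * c * hyp c r.+1 a b) =
    a%:R * c * (((a + b)%:R - r.+1%:R) * hyp c r.+1 a.-1 b + r.+1%:R * c * hyp c r a.-1 b).
  case: a => [|a] in h h0 nz E0 E1 B *; first by rewrite !mul0r mulr0.
  have := IH a b ltac:(lia) => /= E; rewrite mulrCA addSn /= E.
  by rewrite -!natr1; ring.
apply: (mulfI nz); rewrite mulrDr.
have -> : (a + b)%:R * (a.+1%:R * c * hyp c r.+1 a b) =
  c * ((a + b)%:R * hyp c r.+1 a b) + (a + b)%:R * (a%:R * c * hyp c r.+1 a b).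
  by rewrite -natr1; ring.
rewrite A B.
rewrite [RHS]mulrDr [X in _ = X + _]mulrCA E0 [X in _ = _ + X]mulrCA E1.
rewrite -[r.+2%:R]natr1. ring: E1.
Qed.

Lemma hyp_add_good (R : realFieldType) (c : R) r a b : (r <= a + b)%N ->
  (a + b).+1%:R * hyp c r.+1 a b.+1 =
  ((a + b)%:R - r%:R) * hyp c r.+1 a b + r.+1%:R * hyp c r a b.
Proof.
elim: r a b => [|r IH] a b h.
  rewrite -addnS hypS ?addnS // subr0.
  case: (posnP (a + b)) => [/eqP|h0]; last by rewrite hypS // !hyp0 -natr1; ring.
  by rewrite addn_eq0 => /andP[/eqP-> /eqP->]; rewrite hypSE !hyp0 /=; ring.
rewrite -addnS hypS ?addnS //=.
have h0 : (0 < a + b)%N by lia.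
have nz : (a + b)%:R != 0 :> R by rewrite pnatr_eq0; lia.
have E0 := hypS c r.+1 h0.
have E1 := hypS c r h0.
have B : (a + b)%:R * (b%:R * hyp c r.+1 a b) =
    b%:R * (((a + b)%:R - r.+1%:R) * hyp c r.+1 a b.-1 + r.+1%:R * hyp c r a b.-1).
  case: b => [|b] in h h0 nz E0 E1 *; first by rewrite !mul0r mulr0.
  have := IH a b ltac:(lia) => /= E; rewrite mulrCA addnS /= E.
  by rewrite -!natr1; ring.
have A : (a + b)%:R * (a%:R * c * hyp c r.+1 a.-1 b.+1) =
    a%:R * c * (((a + b)%:R - r.+1%:R) * hyp c r.+1 a.-1 b + r.+1%:R * hyp c r a.-1 b).
  case: a => [|a] in h h0 nz E0 E1 B *; first by rewrite !mul0r mulr0.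
  have := IH a b ltac:(lia) => /= E; rewrite mulrCA addSn /= E.
  by rewrite -!natr1; ring.
apply: (mulfI nz); rewrite mulrDr.
have -> : (a + b)%:R * (b.+1%:R * hyp c r.+1 a b) =
  ((a + b)%:R * hyp c r.+1 a b) + (a + b)%:R * (b%:R * hyp c r.+1 a b).
  by rewrite -natr1; ring.
rewrite A B.
rewrite [RHS]mulrDr [X in _ = X + _]mulrCA E0 [X in _ = _ + X]mulrCA E1.
rewrite -[r.+2%:R]natr1. ring: E1.
Qed.

(** * Finite differences *)

Definition fdiff (V : zmodType) (h : nat) (F : nat -> V) (s : nat) : V :=
  F (s + h)%N - F s.

(** Locality matters because [hyp_diff] is available only below a + b draws. *)
Lemma eq_iter_fdiff (V : zmodType) h K (F G : nat -> V) s :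
  (forall j, (j <= K)%N -> F (s + j * h)%N = G (s + j * h)%N) ->
  iter K (fdiff h) F s = iter K (fdiff h) G s.
Proof.
elim: K F G => [|K IH] F G E; first by have := E 0%N isT; rewrite addn0.
rewrite !iterSr; apply: IH => j jK; rewrite /fdiff E; last exact: leqW.
by rewrite -addnA -mulSnr E.
Qed.

Lemma iter_fdiffZ (R : pzRingType) h K (a : R) (F : nat -> R) s :
  iter K (fdiff h) (fun x => a * F x) s = a * iter K (fdiff h) F s.
Proof. by elim: K s => [|K IH] s //=; rewrite /fdiff !IH mulrBr. Qed.

Lemma iter_fdiff_sum (V : zmodType) (I : Type) (r : seq I) (P : pred I) h K
  (F : I -> nat -> V) s :
  iter K (fdiff h) (fun x => \sum_(i <- r | P i) F i x) s =
  \sum_(i <- r | P i) iter K (fdiff h) (F i) s.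
Proof. by elim: K s => [|K IH] s //=; rewrite /fdiff !IH sumrB. Qed.

Lemma hyp_le1 (R : realFieldType) (c : R) x a b : 0 <= c <= 1 ->
  (x <= a + b)%N -> hyp c x a b <= 1.
Proof.
move=> c01 h; apply: le_trans (hyp_le_expn c01 h) _.
have /andP[c0 c1] := c01.
have tt : 0 <= (a%:R / (a + b)%:R : R) <= 1.
  rewrite divr_ge0 //=; case: (posnP (a + b)) => [->|?]; first by rewrite invr0 mulr0.
  by rewrite ler_pdivrMr ?ltr0n // mul1r ler_nat leq_addr.
apply: exprn_ile1; nra.
Qed.

(** Each difference removes a bad element through [hyp_diff]; the factors a/(a + b), (a - 1)/(a + b
    - 1), ... decrease and are replaced by the first. Once the bad elements run out the difference
    vanishes, whence the indicator of K <= a. *)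
Lemma normr_fdiff_hyp (R : realFieldType) (c : R) K x a b :
  (x + K <= a + b)%N ->
  `|iter K (fdiff 1) (fun x => hyp c x a b) x| <=
  (`|1 - c| * (a%:R / (a + b)%:R)) ^+ K * ((K <= a)%N%:R * `|hyp c x (a - K) b|).
Proof.
elim: K a => [|K IH] a h; first by rewrite /= subn0 !mul1r.
have n0 : 0 < (a + b)%:R :> R by rewrite ltr0n; lia.
rewrite iterSr (@eq_iter_fdiff _ _ _ _
  (fun x => (- (1 - c) * (a%:R / (a + b)%:R)) * hyp c x a.-1 b)); last first.
  move=> j jK; rewrite /fdiff addn1.
  apply: (mulfI (lt0r_neq0 n0)); rewrite hyp_diff; last by lia.
  by rewrite -[in LHS](divfK (lt0r_neq0 n0) a%:R); ring.
rewrite iter_fdiffZ.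
case: a => [|a] in h n0 *; first by rewrite !(mul0r, mulr0) normr0.
rewrite !normrM normrN normfV !normr_nat subSS ltnS /=.
have {}IH := IH a ltac:(lia).
have t0 : 0 <= `|1 - c| * (a.+1%:R / (a.+1 + b)%:R).
  by rewrite mulr_ge0 // divr_ge0.
rewrite exprS -[leRHS]mulrA; apply: ler_wpM2l => //.
apply: le_trans IH _; apply: ler_wpM2r; first by rewrite mulr_ge0.
apply: lerXn2r; rewrite ?nnegrE //; first by rewrite mulr_ge0 // divr_ge0.
apply: ler_wpM2l => //.
rewrite ler_pdivlMr // mulrAC.
case: (posnP (a + b)) => [e|e]; first by rewrite e invr0 mulr0 ler0n.
rewrite ler_pdivrMr ?ltr0n // -!natrM ler_nat; nia.
Qed.

(** * Weighted square sums of differences of the eigenvalues *)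

Lemma sum_bin_geo (R : realFieldType) (t : R) L M :
  t * \sum_(x < M) 'C(x + L.+1, L.+1)%:R * (1 - t) ^+ x +
    'C(M + L, L.+1)%:R * (1 - t) ^+ M =
  \sum_(x < M) 'C(x + L, L)%:R * (1 - t) ^+ x.
Proof.
elim: M => [|M IH]; first by rewrite !big_ord0 bin_small // mul0r mulr0 addr0.
rewrite !big_ord_recr /= -IH addSn binS natrD addnS binS natrD exprS; ring.
Qed.

(** x^L is at most L! 'C(x + L, L), and the negative binomial series of 'C(x + L, L) (1 - t)^x sums
    to t^-(L + 1). Keeping the power of t on the left covers t = 0. *)
Lemma sum_expn_geo (R : realFieldType) (t : R) L M : 0 <= t <= 1 ->
  t ^+ L.+1 * \sum_(x < M) x%:R ^+ L * (1 - t) ^+ x <= L`!%:R.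
Proof.
move=> /andP[t0 t1]; have s0 : 0 <= 1 - t by lra.
have B : t ^+ L.+1 * \sum_(x < M) 'C(x + L, L)%:R * (1 - t) ^+ x <= 1.
  elim: L => [|L IH].
    suff -> : t ^+ 1 * \sum_(x < M) 'C(x + 0, 0)%:R * (1 - t) ^+ x = 1 - (1 - t) ^+ M.
      by have := exprn_ge0 M s0; lra.
    elim: M => [|M IH]; first by rewrite big_ord0 expr0; ring.
    by rewrite big_ord_recr /= mulrDr IH bin0 mul1r [in RHS]exprS expr1; ring.
  apply: le_trans IH; rewrite exprSr -mulrA; apply: ler_wpM2l; first exact: exprn_ge0.
  by rewrite -(sum_bin_geo t L M) lerDl mulr_ge0 // exprn_ge0.
rewrite -[leRHS]mulr1; apply: le_trans (ler_wpM2l _ B); last by rewrite ler0n.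
rewrite mulrCA; apply: ler_wpM2l; first exact: exprn_ge0.
rewrite mulr_sumr; apply: ler_sum => x _; rewrite mulrA; apply: ler_wpM2r.
  exact: exprn_ge0.
rewrite -natrX -natrM ler_nat mulnC bin_ffact.
elim: L {B} => [|L IH] //; rewrite addnS ffactnS /= expnS leq_mul //.
by rewrite leqW // leq_addr.
Qed.

(** With K = k + 1, the first term serves K <= a < 2 K and the second 2 K <= a; in both, 4^K bounds
    (1 - c)^(2 K). *)
Definition fdiff_hyp_bound (k : nat) : nat :=
  4 ^ k.+1 * (2 * k.+1) ^ (2 * k.+1) + 4 ^ k.+1 * 4 ^ (2 * k.+1) * (k.*2.+1)`!.

(** With K = k + 1, q = a/(a + b) and a >= 2 K, the squared difference is at most of order q^(2 K)
    (1 - q/4)^x, while the sum of x^(2 K - 1) (1 - q/4)^x is at most of order q^(-2 K). The range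
    keeps x + K within a + b. *)
Lemma sum_sqr_fdiff_hyp (R : realFieldType) (c : R) k a b : -(1/2) <= c <= 0 ->
  \sum_(x < (a + b).+1 - k.+1)
    x%:R ^+ k.*2.+1 * iter k.+1 (fdiff 1) (fun x => hyp c x a b) x ^+ 2
  <= (fdiff_hyp_bound k)%:R.
Proof.
move=> /andP[c1 c2]; set K := k.+1; set n := (a + b)%N.
have k2 : (2 * k.+1 = k.*2.+2)%N by rewrite mul2n doubleS.
have [nK|Kn] := ltnP n K.
  by rewrite (_ : n.+1 - K = 0)%N ?big_ord0 ?ler0n //; apply/eqP; rewrite subn_eq0.
have n0 : 0 < n%:R :> R by rewrite ltr0n; lia.
(* Of the two factors [hyp] in the square one is bounded by 1; a single one carries enough decay.
   Passing to |c| makes it nonnegative. *)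
have P x : (x < n.+1 - K)%N ->
   iter K (fdiff 1) (fun x => hyp c x a b) x ^+ 2 <=
   4 ^+ K * ((K <= a)%N%:R * ((a%:R / n%:R) ^+ (2 * K) * hyp `|c| x (a - K) b)).
  move=> xn; have H := @normr_fdiff_hyp R c K x a b ltac:(lia).
  have [Ka|Ka] := leqP K a; last first.
    move: H; rewrite leqNgt Ka /= !mul0r mulr0 normr_le0 => /eqP ->.
    by rewrite expr0n mulr0.
  move: H; rewrite Ka !mul1r => H.
  have q0 : 0 <= hyp `|c| x (a - K) b by apply: hyp_ge0.
  have q1 : hyp `|c| x (a - K) b <= 1.
    have c01 : 0 <= `|c| <= 1 by rewrite normr_ge0 /= ler_norml; lra.
    by apply: hyp_le1 => //; lia.
  have Q := normr_hyp c x (a - K) b.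
  rewrite -real_normK ?num_real //.
  have {H}H0 := H; have H : `|iter K (fdiff 1) (fun y => hyp c y a b) x| <=
       (`|1 - c| * (a%:R / (a + b)%:R)) ^+ K * hyp `|c| x (a - K) b.
    by apply: le_trans H0 _; apply: ler_wpM2l => //; rewrite exprn_ge0 // mulr_ge0 // divr_ge0.
  apply: le_trans (lerXn2r 2 _ _ H) _; rewrite ?nnegrE //.
    by rewrite mulr_ge0 // exprn_ge0 // mulr_ge0 // divr_ge0.
  rewrite exprMn exprMn exprMn -!exprM [(K * 2)%N]mulnC -mulrA.
  apply: ler_pM; rewrite ?mulr_ge0 ?exprn_ge0 ?divr_ge0 //.
    rewrite exprM; apply: lerXn2r; rewrite ?nnegrE ?exprn_ge0 //.
    rewrite ger0_norm; last by lra.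
    nra.
  apply: ler_wpM2l; first by rewrite exprn_ge0 // divr_ge0.
  by rewrite expr2 ler_piMl.
rewrite /fdiff_hyp_bound natrD.
have [aK|Ka] := ltnP a K.
  rewrite big1 ?addr_ge0 // => x _; have := P x (ltn_ord x).
  rewrite leqNgt aK /= mul0r mulr0 => D0.
  suff -> : iter K (fdiff 1) (fun x => hyp c x a b) x ^+ 2 = 0 by rewrite mulr0.
  by apply/eqP; rewrite eq_le D0 sqr_ge0.
(* With fewer than 2 K bad elements a - K may be 0 and no decay is left; but then a/n < 2 K/n, so
   each of the at most n terms is O(1/n). *)
have [aK|aK] := ltnP a (2 * K).
  apply: (@le_trans _ _ (4 ^ K * (2 * K) ^ (2 * K))%:R); last by rewrite lerDl.
  apply: (@le_trans _ _ (\sum_(x < n.+1 - K) 4 ^+ K * (2 * K)%:R ^+ (2 * K) / n%:R)).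
    apply: ler_sum => x _; have xn := ltn_ord x.
    apply: (@le_trans _ _ (n%:R ^+ k.*2.+1 * (4 ^+ K * ((2 * K)%:R / n%:R) ^+ (2 * K)))).
      apply: ler_pM; rewrite ?sqr_ge0 ?exprn_ge0 //.
        by apply: lerXn2r; rewrite ?nnegrE // ler_nat; lia.
      apply: le_trans (P x xn) _; rewrite Ka mul1r.
      apply: ler_wpM2l; first exact: exprn_ge0.
      rewrite -[leRHS]mulr1; apply: ler_pM; rewrite ?exprn_ge0 ?divr_ge0 ?hyp_ge0 //.
        apply: lerXn2r; rewrite ?nnegrE ?divr_ge0 //.
        by apply: ler_wpM2r; rewrite ?invr_ge0 // ler_nat; lia.
      have c01 : 0 <= `|c| <= 1 by rewrite normr_ge0 /= ler_norml; lra.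
      by apply: hyp_le1 => //; lia.
    rewrite exprMn exprVn; set B := (2 * K)%:R ^+ (2 * K).
    have nz : n%:R ^+ k.*2.+1 != 0 :> R by rewrite expf_neq0 // lt0r_neq0.
    have -> : n%:R ^+ (2 * K) = n%:R ^+ k.*2.+1 * n%:R :> R by rewrite -exprSr -k2.
    by rewrite invfM mulrCA [B * _]mulrCA [n%:R ^+ _ * (_ * _)]mulrA divff // mul1r mulrA.
  rewrite sumr_const card_ord [leRHS]natrM !natrX -[leLHS]mulr_natr.
  rewrite mulrAC ler_pdivrMr //; apply: ler_wpM2l; first by rewrite mulr_ge0 // exprn_ge0.
  by rewrite ler_nat; lia.
apply: (@le_trans _ _ (4 ^ K * 4 ^ (2 * K) * (k.*2.+1)`!)%:R); last by rewrite lerDr.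
(* Since 1 - |c| >= 1/2 and (a - K)/(n - K) >= a/(2 n) for a >= 2 K, the base of the decay is at
   most 1 - a/(4 n). *)
pose t : R := (a%:R / n%:R) / 4.
have aK1 : (K <= a)%N by lia.
have an : 0 <= (a%:R / n%:R : R) <= 1.
  by rewrite divr_ge0 //= ler_pdivrMr // mul1r ler_nat leq_addr.
have t01 : 0 <= t <= 1 by rewrite /t; lra.
apply: (@le_trans _ _ (\sum_(x < n.+1 - K) 4 ^+ K * 4 ^+ (2 * K) * t ^+ (2 * K) *
   (x%:R ^+ k.*2.+1 * (1 - t) ^+ x))).
  apply: ler_sum => x _; have xn := ltn_ord x.
  rewrite [leRHS]mulrCA; apply: ler_wpM2l; first exact: exprn_ge0.
  apply: le_trans (P x xn) _; rewrite Ka mul1r -!mulrA.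
  apply: ler_wpM2l; first exact: exprn_ge0.
  rewrite [leRHS]mulrA -exprMn.
  have -> : 4 * t = a%:R / n%:R by rewrite /t mulrC divfK // pnatr_eq0.
  apply: ler_wpM2l; first by rewrite exprn_ge0 //; lra.
  have c01 : 0 <= `|c| <= 1 by rewrite normr_ge0 /= ler_norml; lra.
  apply: le_trans (hyp_le_expn c01 _) _; first by lia.
  have cc : 1 / 2 <= 1 - `|c| <= 1 by rewrite ler0_norm //; lra.
  have tt : 2 * t <= (a - K)%:R / (a - K + b)%:R.
    rewrite (_ : (a - K + b = n - K)%N); last by lia.
    rewrite ler_pdivlMr ?ltr0n; last by lia.
    rewrite /t -[2]/(2%:R) mulrC mulrA mulrA ler_pdivrMr // mulrA ler_pdivrMr //.
    rewrite -!natrM ler_nat; nia.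
  have tt1 : (a - K)%:R / (a - K + b)%:R <= 1 :> R.
    case: (posnP (a - K + b)) => [->|?]; first by rewrite invr0 mulr0.
    by rewrite ler_pdivrMr ?ltr0n // mul1r ler_nat leq_addr.
  apply: lerXn2r; rewrite ?nnegrE; nra.
rewrite -mulr_sumr -mulrA natrM natrM !natrX; apply: ler_wpM2l.
  by rewrite mulr_ge0 ?exprn_ge0.
by rewrite k2; apply: sum_expn_geo.
Qed.

(** * From differences in the radius to pointwise bounds *)

Lemma iter_fdiff_shift (V : zmodType) h K (F : nat -> V) l s :
  iter K (fdiff h) (fun x => F (x + l)%N) s = iter K (fdiff h) F (s + l)%N.
Proof. by elim: K s => [|K IH] s //=; rewrite /fdiff !IH addnAC. Qed.

(** The top value has coefficient 1 in the K-fold difference, and 2^K bounds the binomial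
    coefficients of the others. *)
Lemma normr_iter_fdiff_head (R : realFieldType) h K (F : nat -> R) s :
  `|F (s + K * h)%N| <=
  `|iter K (fdiff h) F s| + 2 ^+ K * \sum_(j < K) `|F (s + j * h)%N|.
Proof.
elim: K F => [|K IH] F; first by rewrite big_ord0 mulr0 addr0 addn0.
rewrite iterSr; have := IH (fdiff h F); set D := iter _ _ _ s.
have E j : fdiff h F (s + j * h)%N = F (s + j.+1 * h)%N - F (s + j * h)%N.
  by rewrite /fdiff mulSnr addnA.
rewrite E; under eq_bigr do rewrite E.
move=> H.
have H1 : \sum_(i < K) `|F (s + i.+1 * h)%N - F (s + i * h)%N| <=
   \sum_(i < K.+1) `|F (s + i * h)%N| + \sum_(i < K) `|F (s + i * h)%N|.
  rewrite big_ord_recl /= -addrA -[leLHS]add0r lerD //= -big_split /=.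
  by apply: ler_sum => i _; apply: ler_normB.
have H2 := lerB_dist (F (s + K.+1 * h)%N) (F (s + K * h)%N).
have P : 1 <= 2 ^+ K :> R by apply: exprn_ege1; rewrite ler1n.
rewrite big_ord_recr /= in H1 *.
set a := \sum_(i < K) `|F (s + i * h)%N| in H1 *.
set b := \sum_(i < K) `|F (s + i.+1 * h)%N - F (s + i * h)%N| in H H1.
set x := `|F (s + K.+1 * h)%N| in H2 *.
set y := `|F (s + K * h)%N| in H1 H2 *.
have y0 : 0 <= y by apply: normr_ge0.
rewrite exprS; set p := 2 ^+ K in H P *.
have : p * b <= p * (a + y + a) by apply: ler_wpM2l => //; lra.
have : y <= p * y by rewrite ler_peMl.
move: H H2; rewrite -/D -mulrA !mulrDr; lra.
Qed.

Lemma ler_sum_shift (R : realFieldType) (g : nat -> R) l n M :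
  (forall j, 0 <= g j) -> (l + n <= M)%N ->
  \sum_(j < n) g (l + j)%N <= \sum_(j < M) g j.
Proof.
move=> g0 h.
rewrite -(big_mkord xpredT g) (@big_cat_nat _ _ _ (l + n)%N) //=.
rewrite (@big_cat_nat _ _ _ l) //= ?leq_addr //.
have -> : \sum_(l <= i < l + n) g i = \sum_(j < n) g (l + j)%N.
  rewrite -[X in \sum_(X <= _ < _) _]add0n big_addn addKn big_mkord.
  by apply: eq_bigr => j _; rewrite addnC.
rewrite -addrA addrCA lerDl addr_ge0 // sumr_ge0 //.
Qed.

(** A step-h difference is a sum of h unit differences, so the coefficients are those of (1 + z +
    ... + z^(h-1))^(K+1), each at most h^K. *)
Lemma normr_iter_fdiff_step (R : realFieldType) h K (F : nat -> R) s :
  `|iter K.+1 (fdiff h) F s| <=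
  h%:R ^+ K * \sum_(l < h.-1 * K.+1 + 1) `|iter K.+1 (fdiff 1) F (s + l)%N|.
Proof.
have T G x : fdiff h G x = \sum_(l < h) fdiff 1 G (x + l)%N :> R.
  rewrite -(big_mkord xpredT (fun l => fdiff 1 G (x + l)%N)).
  rewrite (eq_bigr (fun l => G (x + l.+1)%N - G (x + l)%N)); last first.
    by move=> l _; rewrite /fdiff addn1 addnS.
  by rewrite (telescope_sumr (fun l => G (x + l)%N)) // addn0.
elim: K F s => [|K IH] F s.
  rewrite /= T mul1r muln1; apply: le_trans (ler_norm_sum _ _ _) _.
  apply: (@ler_sum_shift _ (fun l => `|fdiff 1 F (s + l)|) 0) => //.
  by lia.
rewrite iterSr.
have -> : iter K.+1 (fdiff h) (fdiff h F) s =
   \sum_(l < h) iter K.+1 (fdiff h) (fdiff 1 F) (s + l)%N.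
  rewrite (@eq_iter_fdiff _ _ _ _ (fun x => \sum_(l < h) fdiff 1 F (x + l)%N)) //.
  by rewrite iter_fdiff_sum; apply: eq_bigr => l _; apply: iter_fdiff_shift.
apply: le_trans (ler_norm_sum _ _ _) _.
set S := \sum_(l < h.-1 * K.+2 + 1) _.
apply: (@le_trans _ _ (\sum_(l < h) h%:R ^+ K * S)); last first.
  by rewrite sumr_const card_ord -[leLHS]mulr_natl mulrA exprS.
apply: ler_sum => l _; apply: le_trans (IH _ _) _.
apply: ler_wpM2l; first exact: exprn_ge0.
under eq_bigr do rewrite -addnA -iterSr.
apply: (@ler_sum_shift _ (fun l => `|iter K.+2 (fdiff 1) F (s + l)|)) => //.
by rewrite [(h.-1 * K.+2)%N]mulnS addnA leq_add2r leq_add2r; have := ltn_ord l; lia.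
Qed.

Lemma sqr_sum_le (R : realFieldType) n (g : nat -> R) :
  (\sum_(i < n) g i) ^+ 2 <= n%:R * \sum_(i < n) g i ^+ 2.
Proof.
elim: n => [|n IH]; first by rewrite !big_ord0 mul0r expr0n.
rewrite !big_ord_recr /=; set d := g n.
have : 0 <= \sum_(i < n) (g i - d) ^+ 2 by apply: sumr_ge0 => i _; apply: sqr_ge0.
have -> : \sum_(i < n) (g i - d) ^+ 2 =
   \sum_(i < n) g i ^+ 2 - 2 * d * \sum_(i < n) g i + n%:R * d ^+ 2.
  have -> : n%:R * d ^+ 2 = \sum_(i < n) d ^+ 2 by rewrite sumr_const card_ord mulr_natl.
  rewrite mulr_sumr -sumrB -big_split /=.
  by apply: eq_bigr => i _; ring.
rewrite -natr1; nra.
Qed.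

Lemma ler_sum_progression (R : realFieldType) (F : nat -> R) d r w :
  (forall s, 0 <= F s) -> (0 < d)%N -> (d * w <= r)%N ->
  \sum_(h < w) F (r - d * h.+1)%N <= \sum_(s < r.+1) F s.
Proof.
move=> F0 d0 dw.
apply: (@le_trans _ _ (\sum_(r - d * w <= s < r) F s)).
  elim: w dw => [|w IH] dw; first by rewrite big_ord0 sumr_ge0.
  rewrite big_ord_recr /= (@big_cat_nat _ _ _ (r - d * w)%N) /=; [|lia|lia].
  rewrite addrC lerD //; last by apply: IH; lia.
  by rewrite big_ltn ?lerDl ?sumr_ge0 //; lia.
rewrite big_ord_recr /= -(big_mkord xpredT F) (@big_cat_nat _ _ _ (r - d * w)%N 0) //=; last lia.
by rewrite -addrA addrCA lerDl addr_ge0 ?sumr_ge0.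
Qed.

(** With K = k + 1: 2^K comes from [normr_iter_fdiff_head], a factor K from the number of lower
    points, and 4 K from r + 1 <= 4 K 2^i w. *)
Definition cesaro_const (k : nat) : nat := 2 ^ k.+1 * (4 * k.+1 ^ 2).

(* A K-fold difference with step h relates F r to values at the points
   r - j h, and averaging over h <= w turns these into a Cesaro mean; the error
   is controlled by the weighted l^2 norm of the K-th differences. *)
Lemma le_cesaro_fdiff (R : realFieldType) (F : nat -> R) N k i r (A e : R) :
  (r <= N)%N -> (forall s, 0 <= F s) ->
  (forall n, (n <= N)%N -> \sum_(s < n.+1) F s <= n.+1%:R * A) ->
  0 <= e ->
  \sum_(s < N.+1 - k.+1) s%:R ^+ k.*2.+1 * iter k.+1 (fdiff 1) F s ^+ 2
    <= (2 ^+ k.*2.+1) ^+ i * e ^+ 2 ->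
  F r <= (cesaro_const k)%:R * 2 ^+ i * A + e.
Proof.
move=> rN F0 FA e0 H; set K := k.+1 in H *.
have A0 : 0 <= A by have := FA 0%N isT; rewrite big_ord1 mul1r => /(le_trans (F0 _)).
have two0 : 0 <= 2 ^+ i :> R by apply: exprn_ge0.
(* For h <= w the K-fold difference lives above r - K h >= K h 2^i. There the weight is at least (K
   h 2^i)^(2 K - 1): the power of K h absorbs the cost of the step h, and the power of 2^i cancels
   the one in the hypothesis. *)
pose w := (r %/ (2 * K * 2 ^ i))%N.
have d0 : (0 < 2 * K * 2 ^ i)%N by rewrite muln_gt0 expn_gt0.
have wr : (w * (2 * K * 2 ^ i) <= r)%N by apply: leq_divM.
have rw : (r < w.+1 * (2 * K * 2 ^ i))%N by apply: ltn_ceil.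
have i1 : (1 <= 2 ^ i)%N by rewrite expn_gt0.
have K1 : (1 <= 2 ^ K)%N by rewrite expn_gt0.
have Fr : F r <= r.+1%:R * A.
  by apply: le_trans (FA _ rN); rewrite big_ord_recr /= lerDr sumr_ge0.
(* If r < 2 K 2^i there is no room for a step, but F r <= (r + 1) A is then good enough. *)
case: (posnP w) => [w0|w0].
  apply: le_trans Fr _; rewrite -[leLHS]addr0; apply: lerD => //.
  apply: ler_wpM2r => //; rewrite -natrX -natrM ler_nat.
  rewrite w0 mul1n in rw; apply: leq_trans rw _.
  rewrite leq_mul2r /cesaro_const -/K; apply/orP; right; nia.
have step h : (0 < h <= w)%N -> `|iter K (fdiff h) F (r - K * h)%N| <= e.
  move=> /andP[h0 hw]; set s0 := (r - K * h)%N.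
  have s0h : (K * h * 2 ^ i <= s0)%N.
    rewrite /s0 leq_subRL.
      by apply: leq_trans wr; nia.
    by apply: leq_trans wr; nia.
  apply: le_trans (normr_iter_fdiff_step _ _ _ _) _.
  set n0 := (h.-1 * K + 1)%N.
  have n0h : (n0 <= h * K)%N by rewrite /n0; case: h h0 {hw s0 s0h n0} => //= h _; lia.
  set D := \sum_(l < n0) _.
  have D0 : 0 <= D by apply: sumr_ge0.
  rewrite -(@ler_pXn2r _ 2) ?nnegrE ?mulr_ge0 ?exprn_ge0 //.
  pose Q := \sum_(l < n0) iter K (fdiff 1) F (s0 + l)%N ^+ 2.
  have Q0 : 0 <= Q by apply: sumr_ge0 => l _; apply: sqr_ge0.
  have DQ : D ^+ 2 <= (h * K)%:R * Q.
    apply: le_trans (sqr_sum_le n0 (fun l => `|iter K (fdiff 1) F (s0 + l)%N|)) _.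
    have -> : \sum_(l < n0) `|iter K (fdiff 1) F (s0 + l)%N| ^+ 2 = Q.
      by apply: eq_bigr => l _; rewrite real_normK ?num_real.
    by apply: ler_wpM2r => //; rewrite ler_nat.
  have QH : (K * h)%:R ^+ k.*2.+1 * Q <= e ^+ 2.
    have p0 : 0 < (2 ^+ i) ^+ k.*2.+1 :> R by rewrite !exprn_gt0.
    rewrite -(ler_pM2l p0) mulrA -exprMn.
    apply: (@le_trans _ _ ((2 ^+ k.*2.+1) ^+ i * e ^+ 2)); last first.
      by rewrite -!exprM mulnC.
    apply: le_trans H.
    have hb : (s0 + n0 <= N.+1 - K)%N.
      have Khr : (K * h <= r)%N by apply: leq_trans wr; nia.
      have n0E : (n0 + K = (K * h).+1)%N.
        by rewrite /n0; case: (h) h0 => //= h' _; rewrite mulnS mulnC; lia.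
      by rewrite /s0; lia.
    have w2 j : 0 <= j%:R ^+ k.*2.+1 * iter K (fdiff 1) F j ^+ 2.
      by rewrite mulr_ge0 ?sqr_ge0 ?exprn_ge0.
    apply: le_trans (ler_sum_shift w2 hb).
    rewrite mulr_sumr; apply: ler_sum => l _; apply: ler_wpM2r; first exact: sqr_ge0.
    apply: lerXn2r; rewrite ?nnegrE ?mulr_ge0 //.
    by rewrite -natrX -natrM ler_nat; nia.
  apply: le_trans QH; rewrite exprMn.
  apply: (@le_trans _ _ ((h%:R ^+ k) ^+ 2 * ((h * K)%:R * Q))).
    by apply: ler_wpM2l => //; rewrite sqr_ge0.
  rewrite mulrA; apply: ler_wpM2r => //.
  rewrite -exprM muln2 [(h * K)%N]mulnC exprSr; apply: ler_wpM2r => //.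
  by apply: lerXn2r; rewrite ?nnegrE // ler_nat leq_pmull.
have each h : (h < w)%N ->
    F r <= e + 2 ^+ K * \sum_(j < K) F (r - (K - j) * h.+1)%N.
  move=> hw; have := @normr_iter_fdiff_head R h.+1 K F (r - K * h.+1)%N.
  have hr : (K * h.+1 <= r)%N by apply: leq_trans wr; nia.
  rewrite subnK // ger0_norm // => /le_trans; apply; apply: lerD; first exact: step.
  apply: ler_wpM2l; first exact: exprn_ge0.
  apply: ler_sum => j _; rewrite ger0_norm // le_eqVlt; apply/orP; left; apply/eqP.
  by congr F; have := ltn_ord j; rewrite mulnBl; nia.
have S : w%:R * F r <= w%:R * e + 2 ^+ K * (K%:R * (r.+1%:R * A)).
  have -> : w%:R * F r = \sum_(h < w) F r by rewrite sumr_const card_ord mulr_natl.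
  apply: (@le_trans _ _ (\sum_(h < w) (e + 2 ^+ K * \sum_(j < K) F (r - (K - j) * h.+1)%N))).
    by apply: ler_sum => h _; apply: each.
  rewrite big_split /= sumr_const card_ord -[e *+ w]mulr_natl lerD2l -mulr_sumr.
  apply: ler_wpM2l; first exact: exprn_ge0.
  rewrite exchange_big /= -[K in K%:R]card_ord mulr_natl -sumr_const.
  apply: ler_sum => j _; apply: le_trans (FA _ rN).
  have jK := ltn_ord j.
  apply: ler_sum_progression => //; first by rewrite subn_gt0.
  by apply: leq_trans (leq_mul (leq_subr j K) (leqnn w)) _; apply: leq_trans wr; nia.
rewrite -(ler_pM2l (_ : 0 < w%:R)) ?ltr0n //.
apply: le_trans S _; rewrite addrC mulrDr lerD2r !mulrA.
apply: ler_wpM2r => //; rewrite -!natrX -!natrM ler_nat /cesaro_const -/K.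
have r1 : (r.+1 <= 4 * K * 2 ^ i * w)%N by apply: leq_trans rw _; nia.
apply: leq_trans (leq_mul (leqnn _) r1) _; rewrite expnS expn1; nia.
Qed.

(** * Ergodic averages of the nearest neighbour walk *)

(** The index type [J] covers both uses: pairs of a coordinate and a nonzero increment give one step
    of the walk, and [v := id] gives spherical averages. *)
Definition tavg (R : realFieldType) (G : zmodType) (J : finType) (D : {set J})
    (v : J -> G) (f : G -> R) (x : G) : R :=
  #|D|%:R^-1 * \sum_(j in D) f (x - v j).

Lemma ler_tavg (R : realFieldType) (G : zmodType) (J : finType) (D : {set J})
    (v : J -> G) (f g : G -> R) x :
  (forall z, f z <= g z) -> tavg D v f x <= tavg D v g x.
Proof. by move=> fg; apply: ler_wpM2l; rewrite ?invr_ge0 // ler_sum. Qed.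

Lemma eq_tavg (R : realFieldType) (G : zmodType) (J : finType) (D : {set J})
    (v : J -> G) (f g : G -> R) x :
  f =1 g -> tavg D v f x = tavg D v g x.
Proof. by move=> fg; rewrite /tavg; under eq_bigr do rewrite fg. Qed.

Lemma tavg_ge0 (R : realFieldType) (G : zmodType) (J : finType) (D : {set J})
    (v : J -> G) (f : G -> R) x :
  (forall z, 0 <= f z) -> 0 <= tavg D v f x.
Proof. by move=> f0; rewrite mulr_ge0 ?invr_ge0 // sumr_ge0. Qed.

Lemma tavgB (R : realFieldType) (G : zmodType) (J : finType) (D : {set J})
    (v : J -> G) (f g : G -> R) x :
  tavg D v (fun z => f z - g z) x = tavg D v f x - tavg D v g x.
Proof. by rewrite /tavg sumrB mulrBr. Qed.

Lemma tavg_sum (R : realFieldType) (G : zmodType) (J : finType) (D : {set J})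
    (v : J -> G) (I : Type) (r : seq I) (P : pred I) (f : I -> G -> R) x :
  tavg D v (fun z => \sum_(i <- r | P i) f i z) x =
  \sum_(i <- r | P i) tavg D v (f i) x.
Proof. by rewrite /tavg exchange_big mulr_sumr. Qed.

Lemma tavg_cst (R : realFieldType) (G : zmodType) (J : finType) (D : {set J})
    (v : J -> G) (c : R) x :
  (0 < #|D|)%N -> tavg D v (fun=> c) x = c.
Proof.
move=> D0; rewrite /tavg sumr_const -[X in _ * X]mulr_natl mulrA mulVf ?mul1r //.
by rewrite pnatr_eq0 -lt0n.
Qed.

Lemma sum_tavg (R : realFieldType) (G : finZmodType) (J : finType) (D : {set J})
    (v : J -> G) (f : G -> R) :
  (0 < #|D|)%N -> \sum_x tavg D v f x = \sum_x f x.
Proof.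
move=> D0; rewrite /tavg -mulr_sumr exchange_big /=.
rewrite (eq_bigr (fun=> \sum_x f x)); last first.
  by move=> j _; rewrite [RHS](reindex_inj (addIr (- v j))).
by rewrite sumr_const -[X in _ * X]mulr_natl mulrA mulVf ?mul1r // pnatr_eq0 -lt0n.
Qed.

Lemma eq_iter_tavg (R : realFieldType) (G : zmodType) (J : finType) (D : {set J})
    (v : J -> G) k (f g : G -> R) x :
  f =1 g -> iter k (tavg D v) f x = iter k (tavg D v) g x.
Proof. by move=> fg; elim: k x => [|k IH] x //=; apply: eq_tavg. Qed.

Lemma iter_tavg_cst (R : realFieldType) (G : zmodType) (J : finType) (D : {set J})
    (v : J -> G) k (c : R) x :
  (0 < #|D|)%N -> iter k (tavg D v) (fun=> c) x = c.
Proof.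
move=> D0; elim: k x => [|k IH] x //=.
by rewrite (eq_tavg _ _ (g := fun=> c)) // tavg_cst.
Qed.

Lemma iter_tavgB (R : realFieldType) (G : zmodType) (J : finType) (D : {set J})
    (v : J -> G) k (f g : G -> R) x :
  iter k (tavg D v) (fun z => f z - g z) x =
  iter k (tavg D v) f x - iter k (tavg D v) g x.
Proof.
elim: k x => [|k IH] x //=.
by rewrite -tavgB; apply: eq_tavg.
Qed.

(* Garsia's proof: M := max_(n <= L) S_n satisfies M <= f - l + P M where
   M > 0, and P preserves the total sum. *)
Lemma hopf_maximal (R : realFieldType) (G : finZmodType) (J : finType)
    (D : {set J}) (v : J -> G) (f : G -> R) (l : R) (L : nat) (A : {set G}) :
  (0 < #|D|)%N -> (forall z, 0 <= f z) ->
  (forall x, x \in A -> exists2 n, (n <= L)%N &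
     n%:R * l < \sum_(k < n) iter k (tavg D v) f x) ->
  #|A|%:R * l <= \sum_x f x.
Proof.
move=> D0 f0 HA; set P := tavg D v in HA *.
pose g z := f z - l.
pose S n x := \sum_(k < n) iter k P g x.
have SE n x : S n x = \sum_(k < n) iter k P f x - n%:R * l.
  rewrite /S (eq_bigr (fun k : 'I_n => iter k P f x - l)); last first.
    by move=> k _; rewrite /g iter_tavgB iter_tavg_cst.
  by rewrite sumrB sumr_const card_ord mulr_natl.
have SS n x : S n.+1 x = g x + P (S n) x.
  by rewrite /S big_ord_recl /= /P tavg_sum.
pose M x := \big[Num.max/0]_(n < L.+1) S n x.
have M0 x : 0 <= M x by apply: bigmax_ge_id.
have PM0 x : 0 <= P M x by apply: tavg_ge0.
have SM n x : (n <= L)%N -> S n x <= M x.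
  by move=> nL; apply: (@le_bigmax _ _ _ 0 (fun n : 'I_L.+1 => S n x) (Ordinal (nL : (n < L.+1)%N))).
have MP x : 0 < M x -> M x <= g x + P M x.
  move=> Mx; suff : M x <= Num.max 0 (g x + P M x).
    by rewrite le_max leNgt Mx.
  apply: bigmax_le; first by rewrite le_max lexx.
  move=> [[|n] nL] _ /=; first by rewrite le_max /S big_ord0 lexx.
  by rewrite le_max SS lerD2l; apply/orP; right; apply: ler_tavg => z; apply: SM; lia.
have B : 0 <= \sum_(x | 0 < M x) g x.
  apply: (@le_trans _ _ (\sum_(x | 0 < M x) (M x - P M x))); last first.
    by apply: ler_sum => x /MP; rewrite lerBlDr.
  rewrite sumrB subr_ge0.
  have -> : \sum_(x | 0 < M x) M x = \sum_x M x.
    rewrite big_mkcond /=; apply: eq_bigr => x _; case: ltP => // h.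
    by apply/eqP; rewrite eq_le M0 h.
  rewrite -(sum_tavg v M D0) big_mkcond /=; apply: ler_sum => x _.
  by case: ltP.
have AM : A \subset [set x | 0 < M x].
  apply/subsetP => x /HA[n nL hn]; rewrite inE; apply: lt_le_trans (SM n x nL).
  by rewrite SE subr_gt0.
have [l0|l0] := leP l 0.
  by apply: (@le_trans _ _ 0); rewrite ?sumr_ge0 // mulr_ge0_le0.
apply: (@le_trans _ _ (#|[set x | 0 < M x]|%:R * l)).
  by rewrite ler_pM2r // ler_nat subset_leq_card.
have -> : #|[set x | 0 < M x]|%:R * l = \sum_(x | 0 < M x) l.
  by rewrite sumr_const mulr_natl; congr (_ *+ _); apply: eq_card => x; rewrite !inE.
apply: (@le_trans _ _ (\sum_(x | 0 < M x) f x)).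
  by move: B; rewrite /g sumrB subr_ge0.
by rewrite [leRHS](bigID (fun x => 0 < M x)) /= lerDl sumr_ge0.
Qed.

(** * Hamming norms and the nearest neighbour walk *)

Lemma hamming_normE (m N : nat) (y : 'rV['Z_m.+1]_N) :
  hamming_norm y = (\sum_i (y 0%R i != 0%R))%N.
Proof. by rewrite /hamming_norm -sum1_card big_mkcond /=; apply: eq_bigr => i _; rewrite inE; case: ifP. Qed.

Lemma hamming_norm_le (m N : nat) (y : 'rV['Z_m.+1]_N) : (hamming_norm y <= N)%N.
Proof. by apply: leq_trans (max_card _) _; rewrite card_ord. Qed.

Lemma hamming_normN (m N : nat) (y : 'rV['Z_m.+1]_N) :
  hamming_norm (- y) = hamming_norm y.
Proof. by rewrite !hamming_normE; apply: eq_bigr => i _; rewrite mxE oppr_eq0. Qed.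

Definition axis (m N : nat) (i : 'I_N) (t : 'Z_m.+1) : 'rV['Z_m.+1]_N :=
  \row_j (if j == i then t else 0).

Lemma hamming_norm_axis (m N : nat) (y : 'rV['Z_m.+1]_N) i t :
  (hamming_norm (y - axis i t)%R + (y 0%R i != 0%R) = hamming_norm y + (y 0%R i != t))%N.
Proof.
rewrite !hamming_normE (bigD1 i) //= [in RHS](bigD1 i) //= !mxE eqxx subr_eq0.
have -> : (\sum_(j < N | j != i) ((y - axis i t)%R 0%R j != 0%R) =
   \sum_(j < N | j != i) (y 0%R j != 0%R))%N.
  by apply: eq_bigr => j /negPf ji; rewrite !mxE ji subr0.
by rewrite addnAC [RHS]addnAC [X in (X + _)%N = _]addnC.
Qed.

Lemma card_Zp_neq (m : nat) (t : 'Z_m.+1) : (0 < m)%N -> #|[pred s | s != t]| = m.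
Proof.
by case: m t => // m t _; have := cardC1 t; rewrite card_ord.
Qed.

(** Transition operator of the walk on norms: each of the m changes of a zero coordinate raises the
    norm; of the m changes of a nonzero one, one lowers it and m - 1 keep it. At w = 0 the value
    [phi w.-1] is multiplied by 0. *)
Definition radial_step (R : realFieldType) (m N : nat) (phi : nat -> R) (w : nat) : R :=
  ((N - w)%N%:R * m%:R * phi w.+1 +
   w%:R * (phi w.-1 + m.-1%:R * phi w)) / (N%:R * m%:R).

Lemma sum_hamming_axis (R : realFieldType) (m N : nat) (phi : nat -> R)
    (y : 'rV['Z_m.+1]_N) : (0 < m)%N ->
  \sum_i \sum_(t | t != 0) phi (hamming_norm (y - axis i t)) =
  let w := hamming_norm y in
  (N - w)%N%:R * m%:R * phi w.+1 + w%:R * (phi w.-1 + m.-1%:R * phi w).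
Proof.
move=> m0; set w := hamming_norm y => /=.
have E i : \sum_(t | t != 0) phi (hamming_norm (y - axis i t)) =
   if y 0 i == 0 then m%:R * phi w.+1 else phi w.-1 + m.-1%:R * phi w.
  case: ifP => [/eqP y0|/negbT y0].
    rewrite (eq_bigr (fun=> phi w.+1)).
      by rewrite sumr_const card_Zp_neq // mulr_natl.
    move=> t t0; congr phi; have := hamming_norm_axis y i t.
    by rewrite y0 eqxx [0 == t]eq_sym t0 -/w; lia.
  rewrite (bigD1 (y 0 i)) //=; congr (phi _ + _).
    by have := hamming_norm_axis y i (y 0 i); rewrite y0 eqxx -/w; lia.
  rewrite (eq_bigr (fun=> phi w)).
    rewrite sumr_const mulr_natl; congr (_ *+ _).
    have c := cardD1 (y 0 i) [pred s | s != 0].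
    rewrite card_Zp_neq // inE y0 add1n in c.
    transitivity #|[predD1 [pred s | s != 0] & y 0 i]|.
      by apply: eq_card => t; rewrite !inE andbC.
    by apply/eqP; rewrite -eqSS -c prednK.
  move=> t /andP[_ ty]; congr phi; have := hamming_norm_axis y i t.
  by rewrite y0 [y 0 i == t]eq_sym ty -/w; lia.
under eq_bigr do rewrite E.
have cw : w = #|[pred i | y 0 i != 0]|.
  by rewrite /w /hamming_norm; apply: eq_card => i; rewrite !inE.
have cw' : (N - w)%N = #|[pred i | y 0 i == 0]|.
  rewrite cw -[X in (X - _)%N](card_ord N) -(cardC [pred i | y 0 i == 0]).
  have -> : #|[pred i | y 0 i != 0]| = #|[predC [pred i | y 0 i == 0]]|.
    by apply: eq_card => i; rewrite !inE.
  by rewrite addnK.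
rewrite (bigID (fun i => y 0 i == 0)) /=; congr (_ + _).
  rewrite (eq_bigr (fun=> m%:R * phi w.+1)); last by move=> i ->.
  by rewrite sumr_const cw' -mulrA [RHS]mulr_natl.
rewrite (eq_bigr (fun=> phi w.-1 + m.-1%:R * phi w)); last by move=> i /negPf ->.
by rewrite sumr_const cw [RHS]mulr_natl.
Qed.

Definition unit_steps (m N : nat) : {set 'I_N * 'Z_m.+1} := [set j | j.2 != 0].

Definition walk (R : realFieldType) (m N : nat) (f : 'rV['Z_m.+1]_N -> R) :=
  tavg (unit_steps m N) (fun j => axis j.1 j.2) f.

Lemma card_unit_steps m N : (0 < m)%N -> #|unit_steps m N| = (N * m)%N.
Proof.
move=> m0; rewrite -sum1_card (eq_bigl (fun j : 'I_N * 'Z_m.+1 => xpredT j.1 && (j.2 != 0))).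
  rewrite -(pair_big xpredT (fun t : 'Z_m.+1 => t != 0) (fun _ _ => 1%N)) /=.
  by under eq_bigr do rewrite sum1_card card_Zp_neq //; rewrite sum_nat_const card_ord.
by move=> j; rewrite inE.
Qed.

Lemma unit_steps_gt0 m N : (0 < m)%N -> (0 < N)%N -> (0 < #|unit_steps m N|)%N.
Proof. by move=> m0 N0; rewrite card_unit_steps // muln_gt0 N0. Qed.

Lemma sum_unit_steps (R : realFieldType) m N (F : 'rV['Z_m.+1]_N -> R) :
  \sum_(j in unit_steps m N) F (axis j.1 j.2) =
  \sum_i \sum_(t | t != 0) F (axis i t).
Proof. by rewrite pair_big; apply: eq_bigl => j; rewrite inE. Qed.

Lemma walk_radial (R : realFieldType) m N (psi : nat -> R) (x : 'rV['Z_m.+1]_N) :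
  (0 < m)%N ->
  walk (fun z => psi (hamming_norm z)) x = radial_step m N psi (hamming_norm x).
Proof.
move=> m0; rewrite /walk /tavg card_unit_steps // natrM mulrC /radial_step.
congr (_ / _).
by rewrite (sum_unit_steps (fun v => psi (hamming_norm (x - v)))) sum_hamming_axis.
Qed.

(** Probability that k steps from 0 end at one given point of norm w, not the mass of the whole
    sphere. *)
Definition walk_density (R : realFieldType) (m N k : nat) : nat -> R :=
  iter k (radial_step m N) (fun w => (w == 0%N)%:R).

Lemma walk_density_ge0 (R : realFieldType) m N k w : 0 <= walk_density R m N k w.
Proof.
elim: k w => [|k IH] w; first by rewrite /walk_density /= ler0n.
rewrite /walk_density iterS; apply: divr_ge0; last exact: mulr_ge0.
apply: addr_ge0; first by rewrite !mulr_ge0 ?IH.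
by apply: mulr_ge0 => //; rewrite addr_ge0 ?mulr_ge0 ?IH.
Qed.

Lemma walk_density_eq0 (R : realFieldType) m N k w :
  (k < w)%N -> walk_density R m N k w = 0.
Proof.
elim: k w => [|k IH] w h; first by rewrite /walk_density /= gtn_eqF.
rewrite /walk_density iterS /radial_step -/(walk_density R m N k) !IH; try lia.
by rewrite !(mulr0, addr0, mul0r).
Qed.

Lemma hamming_norm_eq0 m N (y : 'rV['Z_m.+1]_N) : (hamming_norm y == 0%N) = (y == 0).
Proof.
rewrite hamming_normE sum_nat_eq0; apply/forallP/eqP => [h|-> i]; last by rewrite mxE eqxx.
by apply/rowP => i; have := h i; rewrite mxE /= eqb0 negbK => /eqP.
Qed.

Lemma iter_walkE (R : realFieldType) m N k (f : 'rV['Z_m.+1]_N -> R) x :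
  (0 < m)%N ->
  iter k (@walk R m N) f x = \sum_y walk_density R m N k (hamming_norm y) * f (x - y).
Proof.
move=> m0; elim: k x => [|k IH] x.
  rewrite (bigD1 0) //= subr0 big1 ?addr0 => [|y y0].
    by rewrite /walk_density /= hamming_norm_eq0 eqxx mul1r.
  by rewrite /walk_density /= hamming_norm_eq0 (negPf y0) mul0r.
rewrite iterS /walk (eq_tavg _ _ _ IH) /tavg exchange_big mulr_sumr /=.
under eq_bigr do rewrite -/(walk_density R m N k).
transitivity (\sum_y walk (fun z => walk_density R m N k (hamming_norm z)) y * f (x - y)).
  rewrite /walk /tavg.
  under [RHS]eq_bigr do rewrite -mulrA mulr_suml.
  rewrite -!mulr_sumr; congr (_ * _); rewrite exchange_big /= [RHS]exchange_big /=.
  apply: eq_bigr => j _; rewrite [LHS](reindex_inj (addIr (- axis j.1 j.2))) /=.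
  by apply: eq_bigr => y _; congr (_ * f _); rewrite opprB addrA subrK.
by apply: eq_bigr => y _; rewrite walk_radial.
Qed.

(** Both sides are the iterated walk operator applied to a radial function and evaluated at 0, so a
    step may be moved from the density to the test function. *)
Lemma sum_walk_density_step (R : realFieldType) m N k (psi : nat -> R) :
  (0 < m)%N ->
  \sum_(y : 'rV['Z_m.+1]_N) walk_density R m N k.+1 (hamming_norm y) * psi (hamming_norm y) =
  \sum_(y : 'rV['Z_m.+1]_N) walk_density R m N k (hamming_norm y) *
     radial_step m N psi (hamming_norm y).
Proof.
move=> m0.
have E k' (phi : nat -> R) : \sum_(y : 'rV['Z_m.+1]_N) walk_density R m N k' (hamming_norm y) * phi (hamming_norm y) =
   iter k' (@walk R m N) (fun z => phi (hamming_norm z)) 0.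
  by rewrite iter_walkE //; apply: eq_bigr => y _; rewrite sub0r hamming_normN.
rewrite !E iterSr; apply: eq_iter_tavg => z; exact: walk_radial.
Qed.

Lemma sum_walk_density (R : realFieldType) m N k : (0 < m)%N -> (0 < N)%N ->
  \sum_(y : 'rV['Z_m.+1]_N) walk_density R m N k (hamming_norm y) = 1.
Proof.
move=> m0 N0; rewrite -[RHS](iter_tavg_cst (fun j => axis j.1 j.2) k 1 0 (unit_steps_gt0 m0 N0)).
by rewrite -/(walk _) iter_walkE //; apply: eq_bigr => y _; rewrite mulr1.
Qed.

(** The exact drift is 1 - w (m + 1)/(N m), and m + 1 <= 2 m. *)
Lemma radial_step_id (R : realFieldType) m N w : (0 < m)%N -> (0 < N)%N -> (w <= N)%N ->
  w%:R + 1 - 2 * w%:R / N%:R <= radial_step m N (fun v => v%:R : R) w <= w%:R + 1.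
Proof.
move=> m0 N0 wN.
have m0' : 0 < m%:R :> R by rewrite ltr0n.
have N0' : 0 < N%:R :> R by rewrite ltr0n.
have nz : N%:R * m%:R != 0 :> R by rewrite mulf_neq0 ?lt0r_neq0.
have E : radial_step m N (fun v => v%:R : R) w = w%:R + 1 - w%:R * (m%:R + 1) / (N%:R * m%:R).
  apply: (mulIf nz); rewrite /radial_step divfK // mulrBl divfK // natrB //.
  have -> : w%:R * (w.-1%:R + m.-1%:R * w%:R) = w%:R * (w%:R - 1 + (m%:R - 1) * w%:R) :> R.
    case: w {wN} => [|w]; first by rewrite !mul0r.
    by case: m {m0 m0' nz} (m0) => // m _; rewrite /= -!natr1 !addrK.
  by rewrite -natr1; ring.
have t : 0 <= w%:R / (N%:R * m%:R) :> R by rewrite divr_ge0 // mulr_ge0.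
rewrite E; apply/andP; split; last first.
  by rewrite lerBlDr lerDl mulrAC mulr_ge0 // addr_ge0.
rewrite lerD2l lerN2 ler_pdivrMr ?mulr_gt0 //.
have -> : 2 * w%:R / N%:R * (N%:R * m%:R) = 2 * w%:R * m%:R :> R.
  by rewrite mulrA divfK // lt0r_neq0.
have : 1 <= m%:R :> R by rewrite ler1n.
have : 0 <= w%:R :> R by [].
nra.
Qed.

(** A step changes the norm by at most 1, so radius s cannot be jumped over. *)
Lemma radial_step_gt (R : realFieldType) m N s w : (0 < m)%N -> (0 < N)%N -> (w <= N)%N ->
  radial_step m N (fun v => (s < v)%N%:R) w <= (s < w)%N%:R + (w == s)%:R :> R.
Proof.
move=> m0 N0 wN.
have NM0 : 0 < N%:R * m%:R :> R by rewrite mulr_gt0 ?ltr0n.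
have [ws|sw] := ltnP w s.
  have -> : radial_step m N (fun v => (s < v)%N%:R) w = 0 :> R.
    rewrite /radial_step (_ : (s < w.+1)%N = false); last by lia.
    rewrite (_ : (s < w.-1)%N = false); last by lia.
    rewrite (_ : (s < w)%N = false); last by lia.
    by rewrite !(mulr0, addr0, mul0r).
  by rewrite addr_ge0.
apply: (@le_trans _ _ 1); last first.
  by rewrite -natrD ler1n; lia.
rewrite ler_pdivrMr // mul1r -!natrM -!natrD -!natrM -natrD ler_nat.
have := leq_b1 (s < w.+1)%N; have := leq_b1 (s < w.-1)%N; have := leq_b1 (s < w)%N.
set b1 := nat_of_bool _; set b2 := nat_of_bool _; set b3 := nat_of_bool _.
move=> h1 h2 h3.
apply: (@leq_trans ((N - w) * m * 1 + w * (1 + m.-1 * 1))%N).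
  by apply: leq_add; rewrite leq_mul // leq_add // leq_mul.
by rewrite !muln1 add1n prednK // -mulnDl subnK.
Qed.

(* A walk started at 0 that is beyond radius s at time n has visited radius s,
   and the mean radius after 4 r steps is at least 3 r. *)
Lemma walk_visits (R : realFieldType) m N r s : (0 < m)%N -> (0 < r)%N -> (16 * r <= N)%N ->
  (s <= r)%N ->
  1 / 2 <= #|sphere m N s|%:R * \sum_(k < 4 * r) walk_density R m N k s.
Proof.
move=> m0 r0 rN sr; have N0 : (0 < N)%N by lia.
pose T k (psi : nat -> R) := \sum_(y : 'rV['Z_m.+1]_N)
  walk_density R m N k (hamming_norm y) * psi (hamming_norm y).
have TS k psi : T k.+1 psi = T k (radial_step m N psi) by apply: sum_walk_density_step.
have Tle k phi psi : (forall w, (w <= N)%N -> phi w <= psi w) -> T k phi <= T k psi.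
  move=> h; apply: ler_sum => y _; apply: ler_wpM2l; first exact: walk_density_ge0.
  by apply: h; apply: hamming_norm_le.
have TD k phi psi : T k (fun w => phi w + psi w) = T k phi + T k psi.
  by rewrite /T -big_split /=; apply: eq_bigr => y _; rewrite mulrDr.
have TZ k c psi : T k (fun w => c * psi w) = c * T k psi.
  by rewrite /T mulr_sumr; apply: eq_bigr => y _; rewrite mulrCA.
have Tc k c : T k (fun=> c) = c.
  by rewrite /T -mulr_suml sum_walk_density // mul1r.
have T1 k : T k (fun=> 1) = 1.
  exact: Tc.
have T0 psi : T 0%N psi = psi 0%N.
  rewrite /T (bigD1 0) //= big1 ?addr0 => [|y y0].
    have -> : hamming_norm (0 : 'rV['Z_m.+1]_N) = 0%N by apply/eqP; rewrite hamming_norm_eq0.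
    by rewrite /walk_density /= mul1r.
  by rewrite /walk_density /= hamming_norm_eq0 (negPf y0) mul0r.
pose id' : nat -> R := fun w => w%:R.
have N0' : 0 < N%:R :> R by rewrite ltr0n.
have e1 k : T k id' <= k%:R.
  elim: k => [|k IH]; first by rewrite T0.
  rewrite TS; apply: (@le_trans _ _ (T k (fun w => id' w + 1))).
    by apply: Tle => w wN; have /andP[] := radial_step_id R m0 N0 wN.
  by rewrite TD T1 -natr1 lerD2r.
have e2 k : k%:R - k%:R ^+ 2 / N%:R <= T k id'.
  elim: k => [|k IH]; first by rewrite T0 expr2 !mul0r subr0.
  rewrite TS; apply: (@le_trans _ _ (T k (fun w => (1 - 2 / N%:R) * id' w + 1))); last first.
    apply: Tle => w wN; have /andP[h _] := radial_step_id R m0 N0 wN.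
    by apply: le_trans h; rewrite /id' le_eqVlt; apply/orP; left; apply/eqP; ring.
  rewrite TD T1 TZ.
  have := e1 k; set x := T k id' in IH * => xk.
  have u0 : 0 <= N%:R^-1 :> R by rewrite invr_ge0.
  set u := N%:R^-1 in IH u0 *; rewrite -natr1; nra.
have Q (n s' : nat) : T n (fun w => (s' < w)%N%:R) <= \sum_(k < n) T k (fun w => (w == s')%:R).
  elim: n => [|n IH]; first by rewrite T0 big_ord0.
  rewrite TS big_ord_recr /=; apply: le_trans (lerD IH (lexx _)).
  by rewrite -TD; apply: Tle => w wN; apply: radial_step_gt.
have V : \sum_(k < 4 * r) T k (fun w => (w == s)%:R) =
    #|sphere m N s|%:R * \sum_(k < 4 * r) walk_density R m N k s.
  rewrite mulr_sumr; apply: eq_bigr => k _.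
  rewrite /T (bigID (fun y => hamming_norm y == s)) /= [X in _ + X]big1; last first.
    by move=> y /negPf ->; rewrite mulr0.
  rewrite addr0 (eq_bigr (fun=> walk_density R m N k s)); last first.
    by move=> y /eqP ->; rewrite eqxx mulr1.
  rewrite sumr_const mulr_natl; congr (_ *+ _).
  by apply: eq_card => y; rewrite !inE.
rewrite -V; apply: le_trans (Q (4 * r)%N s).
apply: (@le_trans _ _ (T (4 * r)%N (fun w => (r < w)%N%:R))); last first.
  by apply: Tle => w _; rewrite ler_nat; have := sr; lia.
(* The norm at time 4 r is at most 4 r, so its mean is at most r plus 4 r times the probability of
   exceeding r. As N >= 16 r makes the mean at least 3 r, this probability is at least 1/2. *)
have B : T (4 * r)%N id' <= r%:R + (4 * r)%:R * T (4 * r)%N (fun w => (r < w)%N%:R).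
  rewrite -TZ -[X in X + _](Tc (4 * r)%N) -TD.
  apply: ler_sum => y _; set w := hamming_norm y.
  have [h|h] := ltnP (4 * r) w; first by rewrite walk_density_eq0 // !mul0r.
  apply: ler_wpM2l; first exact: walk_density_ge0.
  by rewrite /id' -natrM -natrD ler_nat; case: ltnP => hw; lia.
have := e2 (4 * r)%N; set t := T _ (fun w => (r < w)%N%:R) in B * => h.
have r0' : 0 < r%:R :> R by rewrite ltr0n.
have : (4 * r)%:R ^+ 2 / N%:R <= r%:R :> R.
  by rewrite ler_pdivrMr // -natrX -natrM ler_nat; nia.
have {}B := le_trans h B; move: B; rewrite natrM => B C.
have : r%:R * (1/2) <= r%:R * t by lra.
by rewrite ler_pM2l.
Qed.

(** * Cesaro means of spherical averages *)

Definition sphere_avg (R : realFieldType) (m N s : nat) (f : 'rV['Z_m.+1]_N -> R) :=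
  tavg (sphere m N s) id f.

Lemma sphere_avg0 (R : realFieldType) m N (f : 'rV['Z_m.+1]_N -> R) x :
  sphere_avg 0 f x = f x.
Proof.
have s0 : sphere m N 0 = [set 0].
  by apply/setP => y; rewrite !inE hamming_norm_eq0.
by rewrite /sphere_avg /tavg s0 cards1 big_set1 invr1 mul1r subr0.
Qed.

(** By [walk_visits] the occupation density up to time 4 r gives each sphere of radius s <= r mass
    at least 1/2. Being radial, it dominates half the sum of the uniform measures on these
    spheres. *)
Lemma cesaro_le_walk (R : realFieldType) m N r (f : 'rV['Z_m.+1]_N -> R) x :
  (0 < m)%N -> (0 < r)%N -> (16 * r <= N)%N -> (forall z, 0 <= f z) ->
  \sum_(s < r.+1) sphere_avg s f x <=
  2 * \sum_(k < 4 * r) iter k (@walk R m N) f x.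
Proof.
move=> m0 r0 rN f0.
pose a s := \sum_(k < 4 * r) walk_density R m N k s.
have a0 s : 0 <= a s by apply: sumr_ge0 => k _; apply: walk_density_ge0.
have -> : \sum_(k < 4 * r) iter k (@walk R m N) f x =
    \sum_y a (hamming_norm y) * f (x - y).
  under eq_bigr do rewrite iter_walkE //.
  by rewrite exchange_big /=; apply: eq_bigr => y _; rewrite -mulr_suml.
apply: (@le_trans _ _ (2 * \sum_(s < r.+1) \sum_(y in sphere m N s) a s * f (x - y))).
  rewrite mulr_sumr; apply: ler_sum => s _.
  rewrite /sphere_avg /tavg -mulr_sumr mulrA; apply: ler_wpM2r; first exact: sumr_ge0.
  have := @walk_visits R m N r s m0 r0 rN (ltn_ord s); rewrite -/(a s).
  case: (posnP #|sphere m N s|) => [->|p] h; first by rewrite invr0 mulr_ge0.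
  rewrite -[leLHS]mul1r ler_pdivrMr ?ltr0n //; lra.
apply: ler_wpM2l => //.
rewrite (eq_bigr (fun s : 'I_r.+1 => \sum_y (y \in sphere m N s)%:R * (a (hamming_norm y) * f (x - y)))); last first.
  move=> s _; rewrite big_mkcond /=; apply: eq_bigr => y _; rewrite inE.
  by case: eqP => [->|_]; rewrite ?mul1r ?mul0r.
rewrite exchange_big /=; apply: ler_sum => y _; rewrite -mulr_suml.
rewrite -[leRHS]mul1r; apply: ler_wpM2r; first by rewrite mulr_ge0.
rewrite -natr_sum lern1.
have [h|h] := ltnP (hamming_norm y) r.+1; last first.
  by rewrite big1 // => s _; rewrite inE gtn_eqF //; apply: leq_trans h.
rewrite (bigD1 (Ordinal h)) //= big1 ?addn0 ?leq_b1 // => s sh.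
by rewrite inE; case: eqP => // e; case/eqP: sh; apply: val_inj.
Qed.

Lemma cesaro_weak_type (R : realFieldType) m N (f : 'rV['Z_m.+1]_N -> R) mu
    (A : {set 'rV['Z_m.+1]_N}) :
  (0 < m)%N -> (0 < N)%N -> (forall z, 0 <= f z) -> 0 < mu ->
  (forall x, x \in A -> exists2 n, (n <= N)%N &
     n.+1%:R * mu < \sum_(s < n.+1) sphere_avg s f x) ->
  #|A|%:R * mu <= 24 * \sum_x f x.
Proof.
move=> m0 N0 f0 mu0 HA.
have sa0 s x : 0 <= sphere_avg s f x by apply: tavg_ge0.
(* Averages with 16 n > N are outside the reach of the walk, but they are at most 16 times the mean
   over all radii, which does not depend on n and is handled by Markov's inequality. *)
pose B := [set x | N.+1%:R * (mu / 16) < \sum_(s < N.+1) sphere_avg s f x].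
have HB : #|B|%:R * mu <= 16 * \sum_x f x.
  have N1 : 0 < N.+1%:R :> R by rewrite ltr0n.
  suff : N.+1%:R * (#|B|%:R * (mu / 16)) <= N.+1%:R * \sum_x f x.
    by rewrite ler_pM2l //; lra.
  apply: (@le_trans _ _ (\sum_(x in B) \sum_(s < N.+1) sphere_avg s f x)).
    rewrite mulrCA mulr_natl -sumr_const; apply: ler_sum => x; rewrite inE; exact: ltW.
  apply: (@le_trans _ _ (\sum_x \sum_(s < N.+1) sphere_avg s f x)).
    by rewrite [leRHS](bigID (mem B)) /= lerDl sumr_ge0 // => x _; rewrite sumr_ge0.
  rewrite exchange_big /= mulr_natl -[X in _ *+ X]card_ord -sumr_const; apply: ler_sum => s _.
  case: (posnP #|sphere m N s|) => h; last by rewrite sum_tavg.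
  by rewrite /sphere_avg /tavg -mulr_sumr h invr0 mul0r sumr_ge0.
(* The 8 is 4 times 2: n radii are compared with 4 n walk steps, with a loss of 2. *)
have HC : #|A :\: B|%:R * (mu / 8) <= \sum_x f x.
  apply: (@hopf_maximal _ _ _ (unit_steps m N) (fun j => axis j.1 j.2) f (mu / 8) (4 * N).+1).
  - exact: unit_steps_gt0.
  - by [].
  move=> x; rewrite !inE -leNgt => /andP[xB] /HA[n nN hn].
  case: (posnP n) => [n0|n0].
    exists 1%N => //; rewrite n0 mul1r big_ord1 in hn; rewrite mul1r big_ord1 /=.
    by rewrite sphere_avg0 in hn; lra.
  have [h|h] := leqP (16 * n) N.
    exists (4 * n)%N; first by lia.
    have H := @cesaro_le_walk R m N n f x m0 n0 h f0.
    rewrite -/(walk f).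
    have : (4 * n)%:R * (mu / 8) * 2 < n.+1%:R * mu by rewrite natrM -natr1; nra.
    by move=> hh; have := lt_le_trans (lt_trans hh hn) H; rewrite -/(walk f); lra.
  exfalso; move: hn; apply/negP; rewrite -leNgt.
  apply: (@le_trans _ _ (\sum_(s < N.+1) sphere_avg s f x)).
    rewrite -!(big_mkord xpredT (fun s => sphere_avg s f x)).
    by rewrite [leRHS](@big_cat_nat _ _ _ n.+1) //= lerDl sumr_ge0.
  apply: le_trans xB _; rewrite mulrCA mulrC; apply: ler_wpM2r; first exact: ltW.
  by rewrite ler_pdivrMr // -natrM ler_nat; lia.
have cA : (#|A| <= #|B| + #|A :\: B|)%N.
  by rewrite -(cardsID B A) leq_add2r subset_leq_card // subsetIr.
have : #|A|%:R * mu <= (#|B| + #|A :\: B|)%:R * mu by rewrite ler_pM2r // ler_nat.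
by rewrite natrD mulrDl; lra.
Qed.

(** * Parseval identity for spherical averages *)

(** Sphere in the first n coordinates, kept inside the full space so that an induction on n does not
    change the type of f. *)
Definition part_sphere (m N n r : nat) : {set 'rV['Z_m.+1]_N} :=
  [set y | (hamming_norm y == r) && [forall i : 'I_N, (n <= i)%N ==> (y 0 i == 0)]].

Definition sphere_sum (R : pzRingType) (m N n r : nat) (f : 'rV['Z_m.+1]_N -> R) x : R :=
  \sum_(y in part_sphere m N n r) f (x - y).

Definition axis_sum (R : pzRingType) (m N : nat) (i : 'I_N) (f : 'rV['Z_m.+1]_N -> R) x : R :=
  \sum_(t | t != 0) f (x - axis i t).

Lemma axis0 m N (i : 'I_N) : axis i (0 : 'Z_m.+1) = 0.
Proof. by apply/rowP => j; rewrite !mxE if_same. Qed.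

Lemma axisD m N (i : 'I_N) (s t : 'Z_m.+1) : axis i (s + t) = axis i s + axis i t.
Proof. by apply/rowP => j; rewrite !mxE; case: ifP; rewrite ?addr0. Qed.

(** Translation by [axis i t] identifies the slice of entry t at coordinate i with the sphere on the
    preceding coordinates, of radius r if t = 0 and r - 1 otherwise. *)
Lemma part_sphereS m N (i : 'I_N) r (z : 'rV['Z_m.+1]_N) t :
  (z + axis i t \in part_sphere m N i.+1 r) && ((z + axis i t) 0 i == t) =
  if t == 0 then z \in part_sphere m N i r
  else if r is r'.+1 then z \in part_sphere m N i r' else false.
Proof.
have z0 : (((z + axis i t) 0 i == t) = (z 0 i == 0)).
  by rewrite !mxE eqxx -subr_eq0 addrK.
have H : z 0 i = 0 -> hamming_norm (z + axis i t) = (hamming_norm z + (t != 0%R))%N.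
  move=> zi; have := hamming_norm_axis (z + axis i t) i t.
  by rewrite addrK !mxE eqxx zi add0r eqxx addn0 => <-.
have S : z 0 i = 0 ->
    [forall j : 'I_N, (i < j)%N ==> ((z + axis i t) 0 j == 0)] =
    [forall j : 'I_N, (i <= j)%N ==> (z 0 j == 0)].
  move=> zi; apply: eq_forallb => j; rewrite !mxE.
  case: (ltngtP i j) => [ij|//|/val_inj ij].
    have -> : (j == i) = false by apply/negbTE/eqP => e; rewrite e ltnn in ij.
    by rewrite addr0.
  by rewrite -ij zi eqxx.
rewrite z0 [z + _ \in _]inE.
case: (eqVneq (z 0 i) 0) => [zi|zi]; last first.
  have N0 r0 : (z \in part_sphere m N i r0) = false.
    rewrite inE; apply/negP => /andP[_ /forallP/(_ i)].
    by rewrite leqnn /= (negPf zi).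
  by rewrite andbF; case: ifP => _; rewrite ?N0 //; case: r.
rewrite andbT H // S //; case: (eqVneq t 0) => _; first by rewrite addn0 inE.
by case: r => [|r]; rewrite addn1 // inE eqSS.
Qed.

(** An arbitrary [nmodType] as target lets this serve for counting, with values in [nat], as well as
    for sums of f. *)
Lemma sum_part_sphereS (R : nmodType) m N (i : 'I_N) r (F : 'rV['Z_m.+1]_N -> R) :
  \sum_(y in part_sphere m N i.+1 r) F y =
  \sum_(y in part_sphere m N i r) F y +
  (if r is r'.+1 then
     \sum_(t | t != 0) \sum_(y in part_sphere m N i r') F (y + axis i t) else 0).
Proof.
rewrite (partition_big (fun y : 'rV_N => y 0 i) xpredT) //=.
rewrite (bigD1 0) //=; congr (_ + _).
  rewrite (reindex_inj (addIr (axis i 0))) /=.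
  rewrite (eq_bigl (fun z => z \in part_sphere m N i r)); last first.
    by move=> z; rewrite part_sphereS eqxx.
  by apply: eq_bigr => z _; rewrite axis0 addr0.
have E t : t != 0 -> \sum_(y in part_sphere m N i.+1 r | y 0 i == t) F y =
    if r is r'.+1 then \sum_(y in part_sphere m N i r') F (y + axis i t) else 0.
  move=> t0; rewrite (reindex_inj (addIr (axis i t))) /=.
  under eq_bigl do rewrite part_sphereS (negPf t0).
  by case: r => // ; rewrite big_pred0.
rewrite (eq_bigr _ E).
by case: r {E} => [|r] //; rewrite big1.
Qed.

Lemma sphere_sumS (R : pzRingType) m N (i : 'I_N) r (f : 'rV['Z_m.+1]_N -> R) x :
  sphere_sum i.+1 r f x =
  sphere_sum i r f x + (if r is r'.+1 then sphere_sum i r' (axis_sum i f) x else 0).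
Proof.
rewrite /sphere_sum sum_part_sphereS; congr (_ + _); case: r => // r.
rewrite exchange_big /=; apply: eq_bigr => y _; apply: eq_bigr => t _.
by rewrite opprD addrA.
Qed.

Lemma part_sphereN m N r : part_sphere m N N r = sphere m N r.
Proof.
apply/setP => y; rewrite !inE andb_idr // => _.
by apply/forallP => i; rewrite leqNgt ltn_ord.
Qed.

Lemma part_sphere0 m N r :
  part_sphere m N 0 r = if r is r'.+1 then set0 else [set 0].
Proof.
apply/setP => y; case: r => [|r]; rewrite !inE.
  rewrite hamming_norm_eq0 andb_idr // => /eqP ->.
  by apply/forallP => i; rewrite mxE eqxx.
apply/negP => /andP[h /forallP H].
suff y0 : y == 0 by move: h; rewrite -hamming_norm_eq0 in y0; rewrite (eqP y0).
by apply/eqP/rowP => i; have /eqP := H i; rewrite mxE => ->.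
Qed.

Lemma card_part_sphere m N n r : (0 < m)%N -> (n <= N)%N ->
  #|part_sphere m N n r| = ('C(n, r) * m ^ r)%N.
Proof.
move=> m0; elim: n r => [|n IH] r nN.
  by rewrite part_sphere0; case: r => [|r]; rewrite ?cards1 ?cards0 // bin0n.
rewrite -sum1_card.
have -> : (\sum_(y in part_sphere m N n.+1 r) 1)%N = \sum_(y in part_sphere m N (Ordinal nN).+1 r) 1%N.
  by [].
rewrite (sum_part_sphereS (Ordinal nN) r (fun=> 1%N)) /=.
case: r => [|r].
  by rewrite -[X in X + _ = _]/(\sum_(y in part_sphere m N n 0) 1)%N sum1_card IH ?bin0 ?addr0 // ltnW.
rewrite -[X in X + _ = _]/(\sum_(y in part_sphere m N n r.+1) 1)%N sum1_card IH 1?ltnW //.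
rewrite (eq_bigr (fun=> ('C(n, r) * m ^ r)%N)); last first.
  by move=> t _; rewrite -[LHS]/(\sum_(y in part_sphere m N n r) 1)%N sum1_card IH // ltnW.
rewrite -[X in _ + X]/(\sum_(t : 'Z_m.+1 | t != 0%R) 'C(n, r) * m ^ r)%N sum_nat_const card_Zp_neq //.
by rewrite binS mulnDl expnS; congr (_ + _)%N; rewrite mulnCA.
Qed.

(* The coefficient of z^r in (1 + m z)^(n - k) (1 - z)^k. *)
Definition krawtchouk (R : realFieldType) (m n k r : nat) : R :=
  'C(n, r)%:R * m%:R ^+ r * hyp (- m%:R^-1) r k (n - k).

Lemma krawtchouk0 (R : realFieldType) m n k : krawtchouk R m n k 0 = 1.
Proof. by rewrite /krawtchouk bin0 hyp0 !mulr1. Qed.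

(** A further good coordinate multiplies the generating polynomial by 1 + m z; a further bad one, in
    [krawtchouk_bad], by 1 - z. *)
Lemma krawtchouk_good (R : realFieldType) m n k r : (k <= n)%N ->
  krawtchouk R m n.+1 k r.+1 =
  krawtchouk R m n k r.+1 + m%:R * krawtchouk R m n k r.
Proof.
move=> kn; rewrite /krawtchouk; set c := - _.
have r1 : r.+1%:R != 0 :> R by rewrite pnatr_eq0.
have [nr|rn] := ltnP n r; first by rewrite !bin_small ?mul0r ?mulr0 ?addr0 //; lia.
have := @hyp_add_good R c r k (n - k) ltac:(lia); rewrite subnKC // -subSn //.
set H := hyp c r.+1 k (n.+1 - k); set h1 := hyp c r.+1 k (n - k); set h0 := hyp c r k (n - k) => E.
apply: (mulfI r1).
have E1 : r.+1%:R * 'C(n.+1, r.+1)%:R = n.+1%:R * 'C(n, r)%:R :> R.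
  by rewrite -!natrM -mul_bin_diag.
have E2 : r.+1%:R * 'C(n, r.+1)%:R = (n%:R - r%:R) * 'C(n, r)%:R :> R.
  by rewrite -natrB // -!natrM mul_bin_left.
rewrite exprS mulrDr.
transitivity ((r.+1%:R * 'C(n.+1, r.+1)%:R) * (m%:R * m%:R ^+ r) * H); first by ring.
transitivity ((r.+1%:R * 'C(n, r.+1)%:R) * (m%:R * m%:R ^+ r) * h1 +
   r.+1%:R * (m%:R * ('C(n, r)%:R * m%:R ^+ r * h0))); last by ring.
rewrite E1 E2.
transitivity ('C(n, r)%:R * (m%:R * m%:R ^+ r) * (n.+1%:R * H)); first by ring.
by rewrite E; ring.
Qed.

Lemma krawtchouk_bad (R : realFieldType) m n k r : (0 < m)%N -> (k <= n)%N ->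
  krawtchouk R m n.+1 k.+1 r.+1 =
  krawtchouk R m n k r.+1 - krawtchouk R m n k r.
Proof.
move=> m0 kn; rewrite /krawtchouk; set c := - _.
have r1 : r.+1%:R != 0 :> R by rewrite pnatr_eq0.
have mc : m%:R * c = -1 by rewrite /c mulrN divff // pnatr_eq0 -lt0n.
have [nr|rn] := ltnP n r; first by rewrite !bin_small ?mul0r ?mulr0 ?subr0 //; lia.
have := @hyp_add_bad R c r k (n - k) ltac:(lia); rewrite subnKC // subSS.
set H := hyp c r.+1 k.+1 (n - k); set h1 := hyp c r.+1 k (n - k); set h0 := hyp c r k (n - k) => E.
apply: (mulfI r1).
have E1 : r.+1%:R * 'C(n.+1, r.+1)%:R = n.+1%:R * 'C(n, r)%:R :> R.
  by rewrite -!natrM -mul_bin_diag.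
have E2 : r.+1%:R * 'C(n, r.+1)%:R = (n%:R - r%:R) * 'C(n, r)%:R :> R.
  by rewrite -natrB // -!natrM mul_bin_left.
rewrite exprS mulrBr.
transitivity ((r.+1%:R * 'C(n.+1, r.+1)%:R) * (m%:R * m%:R ^+ r) * H); first by ring.
transitivity ((r.+1%:R * 'C(n, r.+1)%:R) * (m%:R * m%:R ^+ r) * h1 +
   -1 * (r.+1%:R * ('C(n, r)%:R * m%:R ^+ r * h0))); last by ring.
rewrite E1 E2 -mc.
transitivity ('C(n, r)%:R * (m%:R * m%:R ^+ r) * (n.+1%:R * H)); first by ring.
by rewrite E; ring.
Qed.

(** Adjoint of the index shift on the coefficients below M; it moves the r - 1 of the sphere
    recursion onto c. *)
Definition shift_coef (R : nmodType) (M : nat) (c : nat -> R) (r : nat) : R :=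
  if (r.+1 < M)%N then c r.+1 else 0.

Lemma sum_shift_coef (R : pzRingType) M (c V : nat -> R) :
  \sum_(r < M) c r * (if (r : nat) is r'.+1 then V r' else 0) =
  \sum_(r < M) shift_coef M c r * V r.
Proof.
case: M => [|M]; first by rewrite !big_ord0.
rewrite big_ord_recl [RHS]big_ord_recr /= mulr0 add0r {2}/shift_coef ltnn mul0r addr0.
by apply: eq_bigr => r _; rewrite /shift_coef ltnS ltn_ord.
Qed.

(* Splitting f into its mean f0 over coordinate n and f1 := f - f0, the sum of
   f over the nonzero translates along that coordinate is m f0 - f1, and the
   f0 and f1 contributions are orthogonal. *)
Lemma sphere_sum_parseval (R : realFieldType) m N n (f : 'rV['Z_m.+1]_N -> R) :
  (0 < m)%N -> (n <= N)%N ->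
  exists2 E : nat -> R, (forall k, 0 <= E k) &
  forall M (c : nat -> R),
    \sum_x (\sum_(r < M) c r * sphere_sum n r f x) ^+ 2 =
    \sum_(k < n.+1) (\sum_(r < M) c r * krawtchouk R m n k r) ^+ 2 * E k.
Proof.
move=> m0; elim: n f => [|n IH] f nN.
  exists (fun=> \sum_x f x ^+ 2) => [_|M c]; first by apply: sumr_ge0 => x _; apply: sqr_ge0.
  rewrite big_ord1 mulr_sumr; apply: eq_bigr => x _; rewrite -exprMn; congr (_ ^+ 2).
  rewrite mulr_suml; apply: eq_bigr => r _; rewrite -mulrA; congr (_ * _).
  rewrite /sphere_sum part_sphere0 /krawtchouk; case: (val r) => [|r'].
    by rewrite big_set1 subr0 bin0 hyp0 !mul1r.
  by rewrite big_set0 bin_small // !mul0r.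
pose i := Ordinal nN.
pose f0 x := m.+1%:R^-1 * \sum_(t : 'Z_m.+1) f (x - axis i t).
pose f1 x := f x - f0 x.
have q0 : m.+1%:R != 0 :> R by rewrite pnatr_eq0.
have cZ : #|'Z_m.+1| = m.+1 by case: (m) m0 => // m' _; rewrite card_ord.
have f0i x s : f0 (x - axis i s) = f0 x.
  rewrite /f0; congr (_ * _); rewrite [RHS](reindex_inj (addrI s)) /=.
  by apply: eq_bigr => t _; rewrite axisD opprD addrA.
have f1s x : \sum_t f1 (x - axis i t) = 0.
  rewrite /f1 sumrB (eq_bigr _ (fun t _ => f0i x t)) sumr_const -mulr_natl cZ.
  by rewrite /f0 mulVKf // subrr.
have af x : axis_sum i f x = m%:R * f0 x - f1 x.
  have : m.+1%:R * f0 x = \sum_t f (x - axis i t) by rewrite /f0 mulVKf.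
  rewrite (bigD1 0) //= axis0 subr0 -/(axis_sum i f x) /f1 -natr1.
  by move=> h; apply: (addrI (f x)); rewrite -h; ring.
have [E0 E00 H0] := IH f0 (ltnW nN).
have [E1 E10 H1] := IH f1 (ltnW nN).
(* The index k counts the coordinates in which a component of f has mean zero: f0 leaves it
   unchanged, f1 raises it by one. *)
pose E k := (if (k <= n)%N then E0 k else 0) + (if k is k'.+1 then E1 k' else 0).
exists E => [k|M c].
  by rewrite /E addr_ge0 //; [case: ifP | case: k].
pose c0 r := c r + m%:R * shift_coef M c r.
pose c1 r := c r - shift_coef M c r.
pose g0 x := \sum_(r < M) c0 r * sphere_sum n r f0 x.
pose g1 x := \sum_(r < M) c1 r * sphere_sum n r f1 x.
have split x : \sum_(r < M) c r * sphere_sum n.+1 r f x = g0 x + g1 x.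
  transitivity (\sum_(r < M) c r * sphere_sum n r f x +
      \sum_(r < M) shift_coef M c r * sphere_sum n r (axis_sum i f) x).
    rewrite -(sum_shift_coef M c (fun r => sphere_sum n r (axis_sum i f) x)) -big_split /=.
    apply: eq_bigr => r _.
    by rewrite (sphere_sumS i) mulrDr.
  rewrite /g0 /g1 -!big_split /=; apply: eq_bigr => r _.
  have -> : sphere_sum n r f x = sphere_sum n r f0 x + sphere_sum n r f1 x.
    by rewrite /sphere_sum -big_split /=; apply: eq_bigr => y _; rewrite /f1 addrC subrK.
  have -> : sphere_sum n r (axis_sum i f) x = m%:R * sphere_sum n r f0 x - sphere_sum n r f1 x.
    by rewrite /sphere_sum mulr_sumr -sumrB; apply: eq_bigr => y _; rewrite af.
  by rewrite /c0 /c1; ring.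
have g0i x s : g0 (x - axis i s) = g0 x.
  apply: eq_bigr => r _; congr (_ * _); apply: eq_bigr => y _.
  by rewrite addrAC f0i.
have g1s x : \sum_t g1 (x - axis i t) = 0.
  rewrite /g1 exchange_big /= big1 // => r _; rewrite -mulr_sumr /sphere_sum.
  rewrite exchange_big /= big1 ?mulr0 // => y _.
  by rewrite -[RHS](f1s (x - y)); apply: eq_bigr => t _; rewrite addrAC.
have orth : \sum_x g0 x * g1 x = 0.
  apply: (mulfI q0); rewrite mulr0.
  have -> : m.+1%:R * \sum_x g0 x * g1 x = \sum_(t : 'Z_m.+1) \sum_x g0 x * g1 x.
    by rewrite sumr_const cZ mulr_natl.
  transitivity (\sum_(t : 'Z_m.+1) \sum_x g0 x * g1 (x - axis i t)).
    apply: eq_bigr => t _; rewrite (reindex_inj (addIr (- axis i t))) /=.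
    by apply: eq_bigr => x _; rewrite g0i.
  by rewrite exchange_big big1 //= => x _; rewrite -mulr_sumr g1s mulr0.
transitivity (\sum_x g0 x ^+ 2 + \sum_x g1 x ^+ 2).
  rewrite (eq_bigr (fun x => g0 x ^+ 2 + g1 x ^+ 2 + 2 * (g0 x * g1 x))).
    by rewrite !big_split /= -mulr_sumr orth mulr0 addr0.
  by move=> x _; rewrite split; ring.
rewrite H0 H1 /E.
under [RHS]eq_bigr do rewrite mulrDr.
rewrite [RHS]big_split /=; congr (_ + _).
  rewrite [RHS]big_ord_recr /= ltnn mulr0 addr0; apply: eq_bigr => k _.
  rewrite -ltnS ltn_ord; congr (_ ^+ 2 * _).
  transitivity (\sum_(r < M) c r * krawtchouk R m n k r +
      \sum_(r < M) shift_coef M c r * (m%:R * krawtchouk R m n k r)).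
    by rewrite -big_split /=; apply: eq_bigr => r _; rewrite /c0; ring.
  rewrite -(sum_shift_coef M c (fun r => m%:R * krawtchouk R m n k r)) -big_split /=.
  apply: eq_bigr => r _; rewrite -mulrDr; congr (_ * _).
  case: (val r) => [|r']; first by rewrite !krawtchouk0 addr0.
  by rewrite krawtchouk_good // -ltnS.
rewrite [RHS]big_ord_recl /= mulr0 add0r; apply: eq_bigr => k _; congr (_ ^+ 2 * _).
transitivity (\sum_(r < M) c r * krawtchouk R m n k r +
    \sum_(r < M) shift_coef M c r * (- krawtchouk R m n k r)).
  by rewrite -big_split /=; apply: eq_bigr => r _; rewrite /c1; ring.
rewrite -(sum_shift_coef M c (fun r => - krawtchouk R m n k r)) -big_split /=.
apply: eq_bigr => r _; rewrite -mulrDr; congr (_ * _).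
case: (val r) => [|r']; first by rewrite !krawtchouk0 addr0.
by rewrite krawtchouk_bad // -ltnS.
Qed.

Lemma sphere_avgE (R : realFieldType) m N s (f : 'rV['Z_m.+1]_N -> R) x :
  (0 < m)%N ->
  sphere_avg s f x = ('C(N, s)%:R * m%:R ^+ s)^-1 * sphere_sum N s f x.
Proof.
move=> m0; rewrite /sphere_avg /tavg -part_sphereN card_part_sphere //.
by rewrite natrM natrX.
Qed.

(** Choosing E before M and c lets one distribution of energy serve every linear combination of
    radii. The bound M <= N + 1 keeps the spheres nonempty, so that the normalization can be divided
    out. *)
Lemma sphere_avg_parseval (R : realFieldType) m N (f : 'rV['Z_m.+1]_N -> R) :
  (0 < m)%N ->
  exists2 E : nat -> R, (forall k, 0 <= E k) &
  forall M (c : nat -> R), (M <= N.+1)%N ->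
    \sum_x (\sum_(r < M) c r * sphere_avg r f x) ^+ 2 =
    \sum_(k < N.+1) (\sum_(r < M) c r * hyp (- m%:R^-1) r k (N - k)) ^+ 2 * E k.
Proof.
move=> m0; have [E E0 H] := sphere_sum_parseval f m0 (leqnn N).
exists E => // M c MN.
pose b r : R := 'C(N, r)%:R * m%:R ^+ r.
have b0 r : (r <= N)%N -> b r != 0.
  by move=> rN; rewrite mulf_neq0 ?expf_neq0 // pnatr_eq0 -lt0n ?bin_gt0.
have := H M (fun r => c r / b r) => /= {}H.
transitivity (\sum_x (\sum_(r < M) c r / b r * sphere_sum N r f x) ^+ 2).
  apply: eq_bigr => x _; congr (_ ^+ 2); apply: eq_bigr => r _.
  by rewrite sphere_avgE // mulrA.
rewrite H; apply: eq_bigr => k _; congr (_ ^+ 2 * _); apply: eq_bigr => r _.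
rewrite /krawtchouk -/(b r) mulrA divfK // b0 //.
by rewrite -ltnS (leq_trans (ltn_ord r)).
Qed.

(** The coefficients are chosen before G, so the same ones express the difference of the averages at
    every x and of the eigenvalues, as Parseval requires. *)
Lemma iter_fdiff_coef (R : pzRingType) K s :
  exists c : nat -> R, forall G M, (s + K < M)%N ->
    iter K (fdiff 1) G s = \sum_(r < M) c r * G r.
Proof.
elim: K s => [|K IH] s.
  exists (fun r => (r == s)%:R) => G M h; rewrite addn0 in h.
  rewrite (bigD1 (Ordinal h)) //= eqxx mul1r big1 ?addr0 // => i /negPf ih.
  by rewrite (_ : (i == s :> nat) = false) ?mul0r // -ih.
have [c Hc] := IH (s + 1)%N; have [d Hd] := IH s.
exists (fun r => c r - d r) => G M h.
rewrite iterS /fdiff (Hc G M) 1?(Hd G M); try lia.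
by rewrite -sumrB; apply: eq_bigr => r _; rewrite mulrBl.
Qed.

(** Parseval reduces this to [sum_sqr_fdiff_hyp] at each index j with c = -1/m, and m >= 2 gives c
    >= -1/2. *)
Lemma sum_fdiff_sphere_avg (R : realFieldType) m N k (f : 'rV['Z_m.+1]_N -> R) :
  (2 <= m)%N ->
  \sum_x \sum_(s < N.+1 - k.+1)
     s%:R ^+ k.*2.+1 * iter k.+1 (fdiff 1) (fun r => sphere_avg r f x) s ^+ 2
  <= (fdiff_hyp_bound k)%:R * \sum_x f x ^+ 2.
Proof.
move=> m2; have m0 : (0 < m)%N by lia.
have [E E0 H] := sphere_avg_parseval f m0.
pose kap j r : R := hyp (- m%:R^-1) r j (N - j).
have D s : (s < N.+1 - k.+1)%N ->
    \sum_x iter k.+1 (fdiff 1) (fun r => sphere_avg r f x) s ^+ 2 =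
    \sum_(j < N.+1) iter k.+1 (fdiff 1) (kap j) s ^+ 2 * E j.
  move=> h; have [c Hc] := @iter_fdiff_coef R k.+1 s.
  have h' : (s + k.+1 < N.+1)%N by lia.
  under eq_bigr do rewrite (Hc _ N.+1) //.
  by rewrite H //; apply: eq_bigr => j _; rewrite (Hc _ N.+1).
rewrite exchange_big /=.
under eq_bigr => s _ do rewrite -mulr_sumr D // mulr_sumr.
rewrite exchange_big /=.
have -> : \sum_x f x ^+ 2 = \sum_(j < N.+1) E j.
  (* The average of radius 0 is f itself, so Parseval for this single radius computes the total
     energy. *)
  have := H 1%N (fun=> 1) isT; under eq_bigr do rewrite big_ord1 mul1r sphere_avg0.
  move=> ->; apply: eq_bigr => j _.
  by rewrite big_ord1 hyp0 mulr1 expr1n mul1r.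
rewrite mulr_sumr; apply: ler_sum => j _.
under eq_bigr do rewrite mulrA.
rewrite -mulr_suml; apply: ler_wpM2r => //.
have jN : (j <= N)%N by rewrite -ltnS.
have := @sum_sqr_fdiff_hyp R (- m%:R^-1) k j (N - j); rewrite subnKC //; apply.
have m0' : 0 < m%:R :> R by rewrite ltr0n.
rewrite lerN2 oppr_le0 invr_ge0 ler0n andbT mul1r lef_pV2 ?posrE //.
by rewrite ler_nat.
Qed.

(** * Interpolation *)

(** A discrete layer cake: for the least l with 2 a/b^l < u, minimality (or u <= a if l = 0) gives u
    <= 2 b a/b^l. If no l < L qualifies, the last term suffices. *)
Lemma powR_le_levels (R : realType) (u a b p : R) (L : nat) :
  0 <= u <= a -> 1 <= b -> 0 <= p ->
  u `^ p <= \sum_(l < L) (2 * b * (a / b ^+ l)) `^ p * ((2 * (a / b ^+ l) < u)%R)%:R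
            + (2 * b * (a / b ^+ L)) `^ p.
Proof.
move=> /andP[u0 ua] b1 p0.
have a0 : 0 <= a by apply: le_trans ua.
have b0 : 0 < b by lra.
have l0 l : 0 <= a / b ^+ l by rewrite divr_ge0 // exprn_ge0 // ltW.
elim: L => [|L IH].
  rewrite big_ord0 add0r expr0 divr1; apply: ge0_ler_powR; rewrite ?nnegrE //; nra.
rewrite big_ord_recr /=; case: ltP => h.
  by rewrite mulr1; apply: le_trans IH _; rewrite -addrA lerD2l lerDl powR_ge0.
rewrite mulr0 addr0 -[leLHS]add0r; apply: lerD.
  by apply: sumr_ge0 => l _; rewrite mulr_ge0 ?powR_ge0.
have E : 2 * b * (a / b ^+ L.+1) = 2 * (a / b ^+ L).
  by rewrite exprSr invfM mulrA mulrAC -mulrA; field; rewrite expf_neq0 lt0r_neq0.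
by rewrite E; apply: ge0_ler_powR; rewrite ?nnegrE // mulr_ge0.
Qed.

Definition band (R : realFieldType) (T : Type) (f : T -> R) (a b : R) (n : nat) (x : T) : R :=
  if a / b ^+ n.+1 < f x <= a / b ^+ n then f x else 0.

Lemma band_decomposition (R : realFieldType) (T : Type) (f : T -> R) (a b : R) l x :
  0 <= a -> 1 <= b -> f x <= a ->
  f x = (if f x <= a / b ^+ l then f x else 0) + \sum_(n < l) band f a b n x.
Proof.
move=> a0 b1 fa; elim: l => [|l IH]; first by rewrite big_ord0 addr0 expr0 divr1 fa.
have ll : a / b ^+ l.+1 <= a / b ^+ l.
  apply: ler_wpM2l => //; rewrite lef_pV2 ?posrE ?exprn_gt0 //; try lra.
  by rewrite exprS ler_peMl // exprn_ge0 //; lra.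
have E : (if f x <= a / b ^+ l then f x else 0) =
    (if f x <= a / b ^+ l.+1 then f x else 0) + band f a b l x.
  rewrite /band; case: (leP (f x) (a / b ^+ l.+1)) => h /=.
    by rewrite (le_trans h ll) addr0.
  by rewrite add0r.
by rewrite big_ord_recr /= [X in _ + X]addrC addrA -E.
Qed.

Lemma sum_band_le (R : realFieldType) (T : Type) (f : T -> R) (a b : R) L x :
  0 <= f x -> 0 <= a -> 1 <= b -> f x <= a -> \sum_(n < L) band f a b n x <= f x.
Proof.
move=> f0 a0 b1 fa; rewrite [leRHS](@band_decomposition _ _ f a b L) // lerDr.
by case: ifP.
Qed.

(* On the band of height b^d above level t the weak type bound is used with i = d. *)
Lemma dist_le_bands (R : realFieldType) (T : finType) (M : (T -> R) -> T -> R)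
    (b C : R) (f : T -> R) (a : R) (l : nat) :
  (forall J f (g : nat -> T -> R), (forall j x, 0 <= g j x) ->
     (forall x, f x = \sum_(j < J) g j x) ->
     forall x, M f x <= \sum_(j < J) M (g j) x) ->
  (forall g t, (forall x, 0 <= g x <= t) -> forall x, M g x <= t) ->
  (forall i (g : T -> R) mu, (forall x, 0 <= g x) -> 0 < mu ->
     #|[set x | mu < M g x]|%:R <=
     C * (2 ^+ i * (\sum_x g x) / mu + (\sum_x g x ^+ 2) / (b ^+ i * mu ^+ 2))) ->
  0 <= C -> 1 <= b -> 0 < a -> (forall x, 0 <= f x <= a) ->
  #|[set x | 2 * (a / b ^+ l) < M f x]|%:R <=
  \sum_(n < l) 2 * C * 4 ^+ (l - n) * (\sum_x band f a b n x) / (a / b ^+ l).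
Proof.
move=> Hsub Hinf Hweak C0 b1 a0 fa.
have b0 : 0 < b by lra.
set t := a / b ^+ l; have t0 : 0 < t by rewrite divr_gt0 // exprn_gt0.
have F0 n x : 0 <= band f a b n x.
  by rewrite /band; case: ifP => // _; case/andP: (fa x).
(* The heights t/2^(l-n) add up to less than t over n < l, and the part of f below t contributes at
   most t; this accounts for the threshold 2 t. *)
pose mu (n : nat) := t / 2 ^+ (l - n).
pose g j x := if j is n.+1 then band f a b n x else if f x <= t then f x else 0.
have cover : [set x | 2 * t < M f x] \subset
    \bigcup_(n < l) [set x | mu n < M (band f a b n) x].
  apply/subsetP => x; rewrite inE => h; apply/bigcupP.
  have [n hn|hn] := pickP (fun n : 'I_l => mu n < M (band f a b n) x).
    by exists n; rewrite ?inE.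
  have := Hsub l.+1 f g; move=> /(_ _ _ x) H.
  have {}H : M f x <= \sum_(j < l.+1) M (g j) x.
    apply: H => [j y|y]; first by rewrite /g; case: j => // ; case: ifP => // _; case/andP: (fa y).
    have /andP[fy0 fya] := fa y.
    by rewrite big_ord_recl /= /t; apply: band_decomposition => //; apply: ltW.
  exfalso; move: h; apply/negP; rewrite -leNgt; apply: le_trans H _.
  rewrite big_ord_recl (_ : 2 * t = t + t); last by ring.
  apply: lerD.
    apply: Hinf => y; rewrite /g /=; case: ifP => h; last by rewrite lexx ltW.
    by rewrite h andbT; case/andP: (fa y).
  apply: (@le_trans _ _ (\sum_(n < l) mu n)).
    by apply: ler_sum => n _; rewrite leNgt hn.
  rewrite /mu -mulr_sumr -[leRHS]mulr1; apply: ler_wpM2l; first exact: ltW.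
  suff -> : \sum_(n < l) (2 ^+ (l - n))^-1 = 1 - (2 ^+ l)^-1 :> R.
    by rewrite lerBlDr lerDl invr_ge0 exprn_ge0.
  elim: (l) => [|l' IH]; first by rewrite big_ord0 expr0 invr1 subrr.
  rewrite big_ord_recl /= subn0 (eq_bigr (fun n : 'I_l' => (2 ^+ (l' - n))^-1)); last first.
    by move=> n _; rewrite /bump /= add1n subSS.
  by rewrite IH exprS invfM; lra.
apply: (@le_trans _ _ (\sum_(n < l) #|[set x | mu n < M (band f a b n) x]|%:R)).
  rewrite -natr_sum ler_nat; apply: leq_trans (subset_leq_card cover) _.
  elim/big_rec2: _ => [|n y A _ h]; first by rewrite cards0.
  by apply: leq_trans (leq_card_setU _ _) _; rewrite leq_add2l.
apply: ler_sum => n _; have nl := ltn_ord n.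
set d := (l - n)%N; set S := \sum_x band f a b n x.
have S0 : 0 <= S by apply: sumr_ge0.
have p2 : 0 < 2 ^+ d :> R by rewrite exprn_gt0.
have bd0 : 0 < b ^+ d by rewrite exprn_gt0.
have mu0 : 0 < mu n by rewrite divr_gt0.
apply: le_trans (Hweak d _ _ (F0 n) mu0) _.
have tE : a / b ^+ n = t * b ^+ d.
  rewrite /t -[in LHS](subKn (ltnW nl)) -/d.
  have -> : b ^+ l = b ^+ (l - d) * b ^+ d by rewrite -exprD subnK // leq_subr.
  by rewrite invfM mulrA divfK // lt0r_neq0.
have S2 : \sum_x band f a b n x ^+ 2 <= t * b ^+ d * S.
  rewrite /S mulr_sumr; apply: ler_sum => x _; rewrite expr2 -tE; apply: ler_wpM2r => //.
  rewrite /band; case: ifP => [/andP[]//|_]; rewrite tE ltW // mulr_gt0 //.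
rewrite -!mulrA [2 * _]mulrCA; apply: ler_wpM2l => //.
have -> : 4 ^+ d = 2 ^+ d * 2 ^+ d :> R by rewrite -exprMn; congr (_ ^+ _); ring.
have p2n := lt0r_neq0 p2; have tn := lt0r_neq0 t0; have bn := lt0r_neq0 bd0.
have -> : 2 * (2 ^+ d * 2 ^+ d * (S / t)) =
   2 ^+ d * (S / mu n) + (t * b ^+ d * S) / (b ^+ d * mu n ^+ 2).
  by rewrite /mu -/d; field; rewrite p2n tn bn.
rewrite lerD2l; apply: ler_wpM2r => //.
by rewrite invr_ge0 mulr_ge0 ?exprn_ge0 // ltW.
Qed.

Lemma sum_geo_tail_le (R : realFieldType) n L :
  \sum_(l < L | (n < l)%N) (2 ^+ (l - n))^-1 <= 1 :> R.
Proof.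
(* For m <= n + 1 the sum is empty, and truncated subtraction makes the right side 0 as well. *)
suff G m : \sum_(l < m | (n < l)%N) (2 ^+ (l - n))^-1 <= 1 - (2 ^+ (m.-1 - n))^-1 :> R.
  by apply: le_trans (G L) _; rewrite lerBlDr lerDl invr_ge0 exprn_ge0.
elim: m => [|m IH]; first by rewrite big_ord0 sub0n expr0 invr1 subrr.
rewrite big_mkcond big_ord_recr -big_mkcond /=; case: ltnP => nm.
  apply: le_trans (lerD IH (lexx _)) _.
  have -> : (m - n = (m.-1 - n).+1)%N by lia.
  by rewrite exprS invfM; lra.
rewrite addr0; apply: le_trans IH _.
have -> : (m - n = 0)%N by lia.
by have -> : (m.-1 - n = 0)%N by lia.
Qed.

(** Write t_l = a/b^l. As b^(p-1) >= 8, the factor 4^(l-n) of [dist_le_bands] times t_l^(p-1) is at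
    most 2^-(l-n) t_n^(p-1), which can be summed over l. On band n one has t_n < b f, which turns
    t_n^(p-1) f into a multiple of f^p. *)
Lemma strong_type_of_bands (R : realType) (T : finType) (M : (T -> R) -> T -> R)
    (b C p : R) (f : T -> R) :
  (forall J f (g : nat -> T -> R), (forall j x, 0 <= g j x) ->
     (forall x, f x = \sum_(j < J) g j x) ->
     forall x, M f x <= \sum_(j < J) M (g j) x) ->
  (forall g t, (forall x, 0 <= g x <= t) -> forall x, M g x <= t) ->
  (forall i (g : T -> R) mu, (forall x, 0 <= g x) -> 0 < mu ->
     #|[set x | mu < M g x]|%:R <=
     C * (2 ^+ i * (\sum_x g x) / mu + (\sum_x g x ^+ 2) / (b ^+ i * mu ^+ 2))) ->
  (forall g x, 0 <= M g x) ->
  0 <= C -> 2 <= b -> 1 < p -> 8 <= b `^ (p - 1) -> (forall x, 0 <= f x) ->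
  \sum_x M f x `^ p <=
  (2 * b) `^ p * (2 * C * b `^ (p - 1) + 1) * \sum_x f x `^ p.
Proof.
move=> Hsub Hinf Hweak M0 C0 b2 p1 bp f0.
have b0 : 0 < b by lra.
have b1 : 1 <= b by lra.
have p0 : 0 < p by lra.
set be := b `^ (p - 1) in bp *.
have be0 : 0 < be by lra.
pose a := \big[Num.max/0]_x f x.
have fa x : f x <= a by apply: le_bigmax.
have a0 : 0 <= a by apply: bigmax_ge_id.
have rhs0 : 0 <= \sum_x f x `^ p by apply: sumr_ge0 => x _; apply: powR_ge0.
have Ma x : M f x <= a by apply: Hinf => y; rewrite f0 fa.
have K0 : 0 <= (2 * b) `^ p * (2 * C * be + 1).
  apply: mulr_ge0; first exact: powR_ge0.
  have := mulr_ge0 C0 (ltW be0); lra.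
have [ale|agt] := leP a 0.
  rewrite big1 => [|x _]; first exact: mulr_ge0.
  have -> : M f x = 0 by apply/eqP; rewrite eq_le M0 (le_trans (Ma x)).
  by rewrite powR0 // lt0r_neq0.
have a_sum : a `^ p <= \sum_x f x `^ p.
  have : a <= 0 \/ exists x, a <= f x.
    have [x hx|hx] := pickP (fun x => a <= f x); first by right; exists x.
    left; rewrite leNgt; apply/negP => a0'.
    have : a < a; last by rewrite ltxx.
    by rewrite {1}/a; apply: bigmax_lt => // x _; rewrite ltNge hx.
  case=> [h|[x hx]]; first by move: agt; rewrite ltNge h.
  rewrite (bigD1 x) //= -[leLHS]addr0; apply: lerD.
    by apply: ge0_ler_powR; rewrite ?nnegrE // ltW.
  by apply: sumr_ge0 => y _; apply: powR_ge0.
pose t l := a / b ^+ l.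
have t0 l : 0 < t l by rewrite divr_gt0 // exprn_gt0.
have tS l d : t l `^ (p - 1) = t (l + d)%N `^ (p - 1) * be ^+ d.
  elim: d => [|d IH]; first by rewrite addn0 mulr1.
  rewrite IH exprS mulrA; congr (_ * _); rewrite -powRM ?(ltW (t0 _)) ?(ltW b0) //; congr (_ `^ _).
  by rewrite /t addnS exprSr invfM mulrA divfK // lt0r_neq0.
pose F n x := band f a b n x.
have F0 n x : 0 <= F n x by rewrite /F /band; case: ifP.
(* Any L with |T| <= b^L would do: the levels left out then cost at most a^p, which a single point
   of the sum of f^p already pays for. *)
pose L := #|T|.
have tail : #|T|%:R * t L `^ p <= \sum_x f x `^ p.
  apply: le_trans a_sum.
  have u0 : 0 < (b ^+ L)^-1 by rewrite invr_gt0 exprn_gt0.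
  rewrite /t powRM ?(ltW u0) // mulrCA -[leRHS]mulr1; apply: ler_wpM2l; first exact: powR_ge0.
  have u1 : (b ^+ L)^-1 <= 1 by rewrite invf_le1 ?exprn_gt0 // exprn_ege1.
  apply: (@le_trans _ _ (#|T|%:R * (b ^+ L)^-1)).
    by apply: ler_wpM2l => //; apply: ge1r_powR; rewrite ?u0 ?u1 // ltW.
  rewrite ler_pdivrMr ?exprn_gt0 // mul1r.
  apply: (@le_trans _ _ (2 ^+ L)); last by apply: lerXn2r; rewrite ?nnegrE // ltW.
  by rewrite -natrX ler_nat /L ltnW // ltn_expl.
have main : \sum_(l < L) t l `^ p * #|[set x | 2 * t l < M f x]|%:R <=
    2 * C * be * \sum_x f x `^ p.
  apply: (@le_trans _ _ (\sum_(l < L) \sum_(n < L)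
      if (n < l)%N then 2 * C * (2 ^+ (l - n))^-1 * (t n `^ (p - 1) * \sum_x F n x) else 0)).
    apply: ler_sum => l _.
    have H := @dist_le_bands R T M b C f a l Hsub Hinf Hweak C0 b1 agt.
    have {}H := H (fun x => introT andP (conj (f0 x) (fa x))).
    apply: le_trans (ler_wpM2l (powR_ge0 _ _) H) _.
    rewrite mulr_sumr (big_ord_widen _ (fun n => t l `^ p *
      (2 * C * 4 ^+ (l - n) * (\sum_x band f a b n x) / (a / b ^+ l))) (ltnW (ltn_ord l))).
    rewrite big_mkcond /=; apply: ler_sum => n _; case: ifP => // nl.
    rewrite -/(t l); set S := \sum_x F n x.
    have S0 : 0 <= S by apply: sumr_ge0.
    rewrite -(mulr_powRB1 (ltW (t0 l)) p0) -/(t l).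
    rewrite (tS n (l - n)%N) subnKC ?(ltnW nl) //.
    set d := (l - n)%N; set tp := t l `^ (p - 1).
    have tp0 : 0 <= tp by apply: powR_ge0.
    have tn := lt0r_neq0 (t0 l).
    have -> : t l * tp * (2 * C * 4 ^+ d * S / t l) = 2 * C * (tp * S) * 4 ^+ d.
      by field.
    have -> : 2 * C * (2 ^+ d)^-1 * (tp * be ^+ d * S) = 2 * C * (tp * S) * (be ^+ d / 2 ^+ d).
      by ring.
    apply: ler_wpM2l; first by rewrite !mulr_ge0.
    rewrite ler_pdivlMr ?exprn_gt0 // -exprMn; apply: lerXn2r; rewrite ?nnegrE; lra.
  rewrite exchange_big /=.
  apply: (@le_trans _ _ (\sum_(n < L) 2 * C * (t n `^ (p - 1) * \sum_x F n x))).
    apply: ler_sum => n _; rewrite -big_mkcond /=.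
    set S := _ * \sum_x _; have S0 : 0 <= S by rewrite mulr_ge0 ?powR_ge0 ?sumr_ge0.
    rewrite -mulr_suml -mulr_sumr -[leRHS]mulr1 mulrAC; apply: ler_wpM2l.
      by apply: mulr_ge0 => //; apply: mulr_ge0.
    exact: sum_geo_tail_le.
  rewrite -mulr_sumr -!mulrA; do 2! (apply: ler_wpM2l => //).
  rewrite (eq_bigr (fun n : 'I_L => \sum_x t n `^ (p - 1) * F n x)); last first.
    by move=> n _; rewrite mulr_sumr.
  rewrite exchange_big /= mulr_sumr; apply: ler_sum => x _.
  apply: (@le_trans _ _ (\sum_(n < L) be * f x `^ (p - 1) * F n x)).
    apply: ler_sum => n _; rewrite /F /band; case: ifP => [/andP[h _]|_]; last by rewrite !mulr0.
    apply: ler_wpM2r => //; rewrite (tS n 1%N) expr1 mulrC; apply: ler_wpM2l; first exact: ltW.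
    apply: ge0_ler_powR; rewrite ?nnegrE //; [lra | exact: ltW | by rewrite addn1 ltW].
  rewrite -mulr_sumr -mulrA; apply: ler_wpM2l; first exact: ltW.
  rewrite -[in leRHS](mulr_powRB1 (f0 x) p0) mulrC; apply: ler_wpM2r; first exact: powR_ge0.
  exact: sum_band_le.
have lev x : M f x `^ p <= \sum_(l < L) (2 * b * t l) `^ p * ((2 * t l < M f x)%R)%:R
    + (2 * b * t L) `^ p.
  by apply: powR_le_levels; rewrite ?M0 ?Ma //; exact: ltW.
apply: le_trans (ler_sum _ (fun x _ => lev x)) _.
rewrite big_split /= sumr_const -[X in _ + X <= _]mulr_natl exchange_big /=.
have bt l : (2 * b * t l) `^ p = (2 * b) `^ p * t l `^ p.
  by rewrite powRM ?(ltW (t0 _)) // mulr_ge0 // ltW.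
rewrite (eq_bigr (fun l : 'I_L => (2 * b) `^ p * (t l `^ p * #|[set x | 2 * t l < M f x]|%:R))); last first.
  move=> l _; rewrite -mulr_sumr bt -mulrA -natr_sum; congr (_ * (_ * _%:R)).
  by rewrite -sum1_card [RHS]big_mkcond /=; apply: eq_bigr => x _; rewrite inE; case: ifP.
rewrite -mulr_sumr bt mulrCA -mulrDr -[leRHS]mulrA; apply: ler_wpM2l; first exact: powR_ge0.
by rewrite mulrDl mul1r; apply: lerD.
Qed.

(** * The spherical maximal operator *)

Definition sphere_max (R : realFieldType) (m N : nat) (f : 'rV['Z_m.+1]_N -> R) x : R :=
  \big[Num.max/0]_(r < N.+1) sphere_avg r f x.

Lemma sphere_max_ge0 (R : realFieldType) m N (f : 'rV['Z_m.+1]_N -> R) x :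
  0 <= sphere_max f x.
Proof. exact: bigmax_ge_id. Qed.

Lemma sphere_max_le_sum (R : realFieldType) m N J (f : 'rV['Z_m.+1]_N -> R)
    (g : nat -> 'rV['Z_m.+1]_N -> R) :
  (forall j x, 0 <= g j x) -> (forall x, f x = \sum_(j < J) g j x) ->
  forall x, sphere_max f x <= \sum_(j < J) sphere_max (g j) x.
Proof.
move=> g0 fg x; apply: bigmax_le => [|r _].
  by apply: sumr_ge0 => j _; apply: sphere_max_ge0.
rewrite /sphere_avg (eq_tavg _ _ _ fg) tavg_sum; apply: ler_sum => j _.
exact: (@le_bigmax _ _ _ 0 (fun r : 'I_N.+1 => sphere_avg r (g j) x) r).
Qed.

Lemma sphere_max_le_cst (R : realFieldType) m N (f : 'rV['Z_m.+1]_N -> R) t :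
  (0 < m)%N -> (forall x, 0 <= f x <= t) -> forall x, sphere_max f x <= t.
Proof.
move=> m0 ft x; apply: bigmax_le => [|r _].
  by have /andP[h1 h2] := ft x; apply: le_trans h1 h2.
apply: (@le_trans _ _ (sphere_avg r (fun=> t) x)).
  by apply: ler_tavg => z; case/andP: (ft z).
rewrite /sphere_avg tavg_cst // -part_sphereN card_part_sphere //.
by rewrite muln_gt0 bin_gt0 expn_gt0 m0 -ltnS ltn_ord.
Qed.

(** 48 is 24 from [cesaro_weak_type] times 2 from halving mu, and 4 comes from Chebyshev's
    inequality at height mu/2. *)
Definition weak_const (k : nat) : nat := 48 * cesaro_const k + 4 * fdiff_hyp_bound k.

(** Half of mu is allotted to each term of [le_cesaro_fdiff]: outside A the Cesaro means are at most
    [lam], outside B the square function allows e = mu/2, and together they bound every average by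
    mu. *)
Lemma sphere_max_weak_type (R : realFieldType) m N k i (f : 'rV['Z_m.+1]_N -> R) mu :
  (2 <= m)%N -> (0 < N)%N -> (forall x, 0 <= f x) -> 0 < mu ->
  #|[set x | mu < sphere_max f x]|%:R <=
  (weak_const k)%:R * (2 ^+ i * (\sum_x f x) / mu +
     (\sum_x f x ^+ 2) / ((2 ^+ k.*2.+1) ^+ i * mu ^+ 2)).
Proof.
move=> m2 N0 f0 mu0; have m0 : (0 < m)%N by lia.
pose b : R := 2 ^+ k.*2.+1.
have bi0 : 0 < b ^+ i by rewrite !exprn_gt0.
have i0 : 0 < 2 ^+ i :> R by rewrite exprn_gt0.
pose c : R := (cesaro_const k)%:R.
have c0 : 0 < c.
  by rewrite ltr0n /cesaro_const !muln_gt0 !expn_gt0.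
pose lam := mu / (2 * c * 2 ^+ i).
have lam0 : 0 < lam by rewrite divr_gt0 // !mulr_gt0.
pose H x := \sum_(s < N.+1 - k.+1)
     s%:R ^+ k.*2.+1 * iter k.+1 (fdiff 1) (fun r => sphere_avg r f x) s ^+ 2.
have H0 x : 0 <= H x.
  by apply: sumr_ge0 => s _; rewrite mulr_ge0 ?sqr_ge0 ?exprn_ge0.
have sa0 s x : 0 <= sphere_avg s f x by apply: tavg_ge0.
pose A := [set x | [exists n : 'I_N.+1, n.+1%:R * lam < \sum_(s < n.+1) sphere_avg s f x]].
pose B := [set x | b ^+ i * (mu / 2) ^+ 2 < H x].
have cover : [set x | mu < sphere_max f x] \subset A :|: B.
  apply/subsetP => x; rewrite inE => hx; rewrite !inE.
  apply/negP => /negP; rewrite negb_or => /andP[/existsPn hA hB].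
  move: hx; apply/negP; rewrite -leNgt; apply: bigmax_le => [|r _]; first exact: ltW.
  have h2 : 0 <= mu / 2 by lra.
  have rN : (r <= N)%N by rewrite -ltnS.
  have C := @le_cesaro_fdiff R (fun s => sphere_avg s f x) N k i r lam (mu / 2) rN
    (fun s => sa0 s x) _ h2.
  apply: le_trans (C _ _) _.
  - move=> n nN; have := hA (Ordinal (nN : (n < N.+1)%N)).
    by rewrite -leNgt.
  - by move: hB; rewrite -leNgt.
  rewrite -/c; have -> : c * 2 ^+ i * lam = mu / 2.
    by rewrite /lam; field; rewrite (lt0r_neq0 i0) (lt0r_neq0 c0).
  by lra.
have HA : #|A|%:R * lam <= 24 * \sum_x f x.
  apply: (@cesaro_weak_type R m N f lam A m0 N0 f0 lam0) => x.
  by rewrite inE => /existsP[n hn]; exists (n : nat) => //; rewrite -ltnS.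
have HB : #|B|%:R * (b ^+ i * (mu / 2) ^+ 2) <= (fdiff_hyp_bound k)%:R * \sum_x f x ^+ 2.
  apply: le_trans (sum_fdiff_sphere_avg k f m2).
  apply: (@le_trans _ _ (\sum_(x in B) H x)).
    rewrite mulr_natl -sumr_const; apply: ler_sum => x; rewrite inE; exact: ltW.
  have -> : \sum_x H x = \sum_(x in B) H x + \sum_(x | x \notin B) H x by apply: bigID.
  by rewrite lerDl; apply: sumr_ge0 => x _; apply: H0.
have S1 : 0 <= \sum_x f x by apply: sumr_ge0.
have S2 : 0 <= \sum_x f x ^+ 2 by apply: sumr_ge0 => x _; apply: sqr_ge0.
have d0 : 0 < b ^+ i * (mu / 2) ^+ 2 by rewrite mulr_gt0 // exprn_gt0 // divr_gt0.
apply: (@le_trans _ _ (#|A|%:R + #|B|%:R)).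
  rewrite -natrD ler_nat; apply: leq_trans (subset_leq_card cover) _.
  exact: leq_card_setU.
set X := 2 ^+ i * _ / mu; set Y := _ / (_ * mu ^+ 2).
have X0 : 0 <= X by rewrite divr_ge0 ?mulr_ge0 // ltW.
have Y0 : 0 <= Y by rewrite divr_ge0 // ltW // mulr_gt0 // exprn_gt0.
have EA : #|A|%:R <= 48 * c * X.
  rewrite -ler_pdivlMr // in HA; apply: le_trans HA _.
  rewrite le_eqVlt; apply/orP; left; apply/eqP.
  by rewrite /X /lam; field; rewrite (lt0r_neq0 mu0) (lt0r_neq0 i0) (lt0r_neq0 c0).
have EB : #|B|%:R <= 4 * (fdiff_hyp_bound k)%:R * Y.
  rewrite -ler_pdivlMr // in HB; apply: le_trans HB _.
  rewrite le_eqVlt; apply/orP; left; apply/eqP.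
  by rewrite /Y -/b; field; rewrite (lt0r_neq0 mu0) (lt0r_neq0 bi0).
rewrite /weak_const natrD [(48 * _)%:R]natrM [(4 * _)%:R]natrM -/c.
have bb0 : 0 <= (fdiff_hyp_bound k)%:R :> R by [].
set z := (fdiff_hyp_bound k)%:R in EB bb0 *.
have := mulr_ge0 (ltW c0) Y0; have := mulr_ge0 bb0 X0.
have -> : (48 * c + 4 * z) * (X + Y) =
   48 * c * X + 48 * (c * Y) + (4 * (z * X) + 4 * z * Y) by ring.
by lra.
Qed.

Lemma sphere_max_strong_type (R : realType) m (p : R) : 1 < p -> (2 <= m)%N ->
  exists2 K : R, 0 <= K & forall N (f : 'rV['Z_m.+1]_N -> R), (0 < N)%N ->
    (forall x, 0 <= f x) ->
    \sum_x sphere_max f x `^ p <= K * \sum_x f x `^ p.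
Proof.
move=> p1 m2; have p10 : 0 < p - 1 by lra.
(* This makes (k + 1)(p - 1) > 3, hence b^(p-1) >= 2^3. The final constant is built from p alone. *)
pose k := Num.truncn (3 / (p - 1)).
pose b : R := 2 ^+ k.*2.+1.
have b2 : 2 <= b by rewrite /b exprS ler_peMr // exprn_ege1 // ler1n.
have bp : 8 <= b `^ (p - 1).
  rewrite /b -powR_mulrn // -powRrM.
  have -> : 8 = 2 `^ 3%:R :> R by rewrite powR_mulrn //; ring.
  apply: ler_powR; first by rewrite ler1n.
  have : 3 / (p - 1) < k.+1%:R by apply: truncnS_gt.
  rewrite ltr_pdivrMr // => /ltW /le_trans; apply; apply: ler_wpM2r; first exact: ltW.
  by rewrite ler_nat; lia.
pose C : R := (weak_const k)%:R.
exists ((2 * b) `^ p * (2 * C * b `^ (p - 1) + 1)) => [|N f N0 f0].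
  have C0 : 0 <= C by [].
  apply: mulr_ge0; first exact: powR_ge0.
  have := mulr_ge0 C0 (powR_ge0 b (p - 1)); lra.
apply: (@strong_type_of_bands R _ (@sphere_max R m N) b C p f) => //.
- by move=> J g h h0 gh x; apply: sphere_max_le_sum.
- by move=> g t gt x; apply: sphere_max_le_cst => //; lia.
- by move=> i g mu g0 mu0; apply: sphere_max_weak_type.
- by move=> g x; apply: sphere_max_ge0.
Qed.

Lemma normc_convolution_sigma (R : realType) m N r (f : 'rV['Z_m.+1]_N -> R[i]) x :
  ComplexField.Normc.normc (convolution (@sigma R m N r) f x) <=
  sphere_avg r (fun y => ComplexField.Normc.normc (f y)) x.
Proof.
(* On [Rcomplex R] the modulus is a norm with values in R, so the triangle inequality for sums
   applies without leaving the reals. *)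
have nE (z : Rcomplex R) : ComplexField.Normc.normc z = `|z| by exact: erefl.
have n1 : ComplexField.Normc.normc (1 : R[i]) = 1 by exact: ComplexField.Normc.normc1.
have nn n : ComplexField.Normc.normc (n%:R : R[i]) = n%:R.
  by rewrite nE (normrMn (1 : Rcomplex R)) -nE n1.
rewrite /convolution nE.
apply: le_trans (@ler_norm_sum R (Rcomplex R) _ _ _ _) _.
rewrite /sphere_avg /tavg mulr_sumr [leRHS]big_mkcond /=.
apply: ler_sum => y _; rewrite -nE ComplexField.Normc.normcM /sigma.
rewrite ComplexField.Normc.normcM ComplexField.Normc.normcV !nn.
by case: ifP => _; rewrite ?mulr1 // mulr0 mul0r.
Qed.

Theorem theorem1p3 (R : realType) (p : R) (m : nat) (hp : 1 < p) (hm : (2 <= m)%N) :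
  exists C : R, forall (N : nat), (1 <= N)%N ->
    forall f : 'rV['Z_m.+1]_N -> R[i],
      Lp_norm p (spherical_maximal f : _ -> R) <=
        C * Lp_norm p (f : _ -> Rcomplex R).
Proof.
have [K K0 H] := sphere_max_strong_type hp hm.
exists (K `^ p^-1) => N N0 f.
have p0 : 0 < p by lra.
pose g y := ComplexField.Normc.normc (f y).
have g0 y : 0 <= g y by apply: (@normr_ge0 R (Rcomplex R)).
rewrite /Lp_norm -powRM //; last by apply: sumr_ge0 => x _; apply: powR_ge0.
apply: ge0_ler_powR; rewrite ?nnegrE ?invr_ge0 ?(ltW p0) ?mulr_ge0 //.
- by apply: sumr_ge0 => x _; apply: powR_ge0.
- by apply: sumr_ge0 => x _; apply: powR_ge0.
apply: le_trans (H N g N0 g0); apply: ler_sum => x _.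
have m0 : 0 <= spherical_maximal f x by apply: bigmax_ge_id.
rewrite ger0_norm //; apply: ge0_ler_powR; rewrite ?nnegrE ?sphere_max_ge0 ?(ltW p0) //.
apply: bigmax_le => [|r _]; first exact: sphere_max_ge0.
apply: le_trans (normc_convolution_sigma r f x) _.
exact: (@le_bigmax _ _ _ 0 (fun r : 'I_N.+1 => sphere_avg r g x) r).
Qed.
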